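(* Let $n\ge 1$ be an integer and $0<s<1$. Let $\gamma(n,s)>0$ be the number identified by $$\gamma(n,s)\int_{\mathbb R^n}\frac{1-\cos(z_n)}{|z|^{n+2s}}\,dz=1,$$ where $z_n$ is the last coordinate of $z$, and let $(-\Delta)^s$ be defined with this constant, i.e. $$(-\Delta)^s u(x)=\frac{\gamma(n,s)}{2}\int_{\mathbb R^n}\frac{2u(x)-u(x+y)-u(x-y)}{|y|^{n+2s}}\,dy .$$ Then for any $u\in\mathscr S(\mathbb R^n)$ we have $$\widehat{(-\Delta)^s u}(\xi)=(2\pi|\xi|)^{2s}\,\hat u(\xi).$$
   Context: $\mathscr S(\mathbb R^n)$ is the Schwartz space. The Fourier transform of $f\in L^1(\mathbb R^n)$ is $\hat f(\xi)=\int_{\mathbb R^n}e^{-2\pi i\langle\xi,x\rangle}f(x)\,dx$. For $u\in\mathscr S(\mathbb R^n)$ the function $(-\Delta)^s u$ belongs to $L^1(\mathbb R^n)$. *)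

(* Defs.v *)
From HB Require Import structures.
From mathcomp Require Import all_boot all_order all_algebra.
From mathcomp Require Import all_classical all_reals all_analysis.
From mathcomp Require Import complex.

Set Implicit Arguments.
Unset Strict Implicit.
Unset Printing Implicit Defensive.
Import Order.TTheory GRing.Theory Num.Theory.
Import numFieldNormedType.Exports.

Local Open Scope classical_set_scope.
Local Open Scope ring_scope.
Local Open Scope complex_scope.

Definition measure_rV_display : measure_display.
Proof. exact: default_measure_display. Qed.

(* The sigma-algebra of R^n is generated by the coordinate functions, R being
   equipped with its Borel sigma-algebra: this is the Borel sigma-algebra. *)
Section measurable_rV.
Context {R : realType} (n : nat).

Definition rV_coord (i : 'I_n) (x : 'rV[R]_n) : measurableTypeR R := x 0 i.

Let rV_set0 : g_sigma_preimage rV_coord set0.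
Proof. exact: sigma_algebra0. Qed.

Let rV_setC A : g_sigma_preimage rV_coord A -> g_sigma_preimage rV_coord (~` A).
Proof. exact: sigma_algebraC. Qed.

Let rV_bigcup (F : (set 'rV[R]_n)^nat) :
  (forall i, g_sigma_preimage rV_coord (F i)) ->
  g_sigma_preimage rV_coord (\bigcup_i F i).
Proof. exact: sigma_algebra_bigcup. Qed.

HB.instance Definition _ := @isMeasurable.Build measure_rV_display
  'rV[R]_n (g_sigma_preimage rV_coord) rV_set0 rV_setC rV_bigcup.

End measurable_rV.

Lemma measurable_rV_coord (R : realType) n (i : 'I_n) :
  measurable_fun [set: 'rV[R]_n] (rV_coord i).
Proof.
move=> _ Y mY; rewrite setTI; apply: sub_sigma_algebra => /=.
rewrite -bigcup_seq/=; exists i => /=; first by rewrite mem_index_enum.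
by exists Y => //; rewrite setTI.
Qed.

Lemma measurable_fun_rVP d (T : measurableType d) (R : realType) n
    (f : T -> 'rV[R]_n) :
  (forall i, measurable_fun [set: T] (rV_coord i \o f)) ->
  measurable_fun [set: T] f.
Proof.
move=> mf; suff: g_sigma_preimage (fun i => rV_coord i \o f) `<=` measurable.
  by rewrite g_sigma_preimage_comp => h _ A mA; apply: h; exists A.
apply: smallest_sub; first exact: sigma_algebra_measurable.
rewrite -bigcup_seq/=; apply: bigcup_sub => i _ A [B mB <-]; exact: mf.
Qed.

Section lebesgue_rV_step.
Context {R : realType} (n : nat).

Definition rV_cons (p : measurableTypeR R * 'rV[R]_n) : 'rV[R]_n.+1 :=
  row_mx (const_mx p.1 : 'rV[R]_1) p.2.

Definition rV_uncons (v : 'rV[R]_n.+1) : measurableTypeR R * 'rV[R]_n :=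
  (v 0 0, \row_j v 0 (lift 0 j)).

Lemma rV_cons0 p : rV_cons p 0 0 = p.1.
Proof.
have -> : (0 : 'I_n.+1) = lshift n (0 : 'I_1) by exact: ord_inj.
by rewrite /rV_cons [LHS](row_mxEl (const_mx p.1) p.2) mxE.
Qed.

Lemma rV_consS p j : rV_cons p 0 (lift 0 j) = p.2 0 j.
Proof.
have -> : lift 0 j = rshift 1 j by exact: ord_inj.
exact: (row_mxEr (const_mx p.1) p.2).
Qed.

Lemma rV_consK : cancel rV_cons rV_uncons.
Proof.
move=> [a v]; rewrite /rV_uncons rV_cons0; congr pair.
by apply/rowP => j; rewrite mxE rV_consS.
Qed.

Lemma rV_unconsK : cancel rV_uncons rV_cons.
Proof.
move=> v; apply/rowP => i; have [j ->|->] := unliftP 0 i.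
  by rewrite rV_consS mxE.
by rewrite rV_cons0.
Qed.

Lemma measurable_rV_cons : measurable_fun setT rV_cons.
Proof.
apply: measurable_fun_rVP => i; have [j ->|->] := unliftP 0 i.
  rewrite (_ : _ \o _ = rV_coord j \o snd).
    by apply: measurableT_comp => //; exact: measurable_rV_coord.
  by apply/funext => p; exact: rV_consS.
rewrite (_ : _ \o _ = fst)//.
by apply/funext => p; exact: rV_cons0.
Qed.

Lemma measurable_rV_uncons : measurable_fun setT rV_uncons.
Proof.
apply/measurable_fun_pairP; split; first exact: (measurable_rV_coord 0).
apply: measurable_fun_rVP => j.
rewrite (_ : _ \o _ = rV_coord (lift 0 j)); first exact: measurable_rV_coord.
by apply/funext => v /=; rewrite /rV_coord mxE.
Qed.

Variable mu : {sigma_finite_measure set 'rV[R]_n -> \bar R}.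

Definition lebesgue_rV_step : set 'rV[R]_n.+1 -> \bar R :=
  pushforward (@lebesgue_measure R \x mu)%E rV_cons.

Let step0 : lebesgue_rV_step set0 = 0%E.
Proof. by rewrite /lebesgue_rV_step /pushforward preimage_set0 measure0. Qed.

Let step_ge0 A : (0 <= lebesgue_rV_step A)%E.
Proof. by rewrite /lebesgue_rV_step /pushforward measure_ge0. Qed.

Let step_sigma_additive : semi_sigma_additive lebesgue_rV_step.
Proof.
have mc A : measurable A -> measurable (rV_cons @^-1` A).
  by move=> mA; rewrite -[X in measurable X]setTI; exact: measurable_rV_cons.
move=> F mF tF mUF; rewrite /lebesgue_rV_step /pushforward preimage_bigcup.
apply: measure_semi_sigma_additive.
- by move=> i; exact: mc.
- apply/trivIsetP => /= i j _ _ ij; rewrite -preimage_setI.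
  by move/trivIsetP : tF => /(_ _ _ _ _ ij) ->//; rewrite preimage_set0.
- by rewrite -preimage_bigcup; exact: mc.
Qed.

HB.instance Definition _ := isMeasure.Build _ _ _ lebesgue_rV_step
  step0 step_ge0 step_sigma_additive.

Let step_sigma_finite : sigma_finite setT lebesgue_rV_step.
Proof.
have /sigma_finiteP[F [TF ndF Foo]] := sigma_finiteT (@lebesgue_measure R).
have /sigma_finiteP[G [TG ndG Goo]] := sigma_finiteT mu.
exists (fun i => rV_uncons @^-1` (F i `*` G i)).
  rewrite -preimage_bigcup; apply/esym/seteqP; split=> // v _ /=.
  have [i _ Fi] : (\bigcup_i F i) (rV_uncons v).1 by rewrite -TF.
  have [j _ Gj] : (\bigcup_i G i) (rV_uncons v).2 by rewrite -TG.
  exists (maxn i j) => //; split.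
  - by move: Fi; exact/subsetPset/ndF/leq_maxl.
  - by move: Gj; exact/subsetPset/ndG/leq_maxr.
move=> i; have [mF Fi] := Foo i; have [mG Gi] := Goo i; split.
  rewrite -[X in measurable X]setTI; apply: measurable_rV_uncons => //.
  exact: measurableX.
rewrite /lebesgue_rV_step /pushforward -comp_preimage.
rewrite (_ : rV_uncons \o _ = id); last by apply/funext => p /=; rewrite rV_consK.
by rewrite preimage_id product_measure1E// lte_mul_pinfty// ge0_fin_numE.
Qed.

HB.instance Definition _ := Measure_isSigmaFinite.Build _ _ _
  lebesgue_rV_step step_sigma_finite.

End lebesgue_rV_step.

(* n-dimensional Lebesgue measure, as an n-fold product measure; see
   lebesgue_rV_box below for its value on boxes *)
Fixpoint lebesgue_rV {R : realType} (n : nat) :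
    {sigma_finite_measure set 'rV[R]_n -> \bar R} :=
  match n with
  | 0 => [the {sigma_finite_measure set 'rV[R]_0 -> \bar R} of \d_(0 : 'rV[R]_0)]
  | m.+1 => [the {sigma_finite_measure set 'rV[R]_m.+1 -> \bar R} of
              lebesgue_rV_step (lebesgue_rV m)]
  end.

Lemma measurable_box (R : realType) n (A : 'I_n -> set (measurableTypeR R)) :
  (forall i, measurable (A i)) ->
  measurable [set x : 'rV[R]_n | forall i, A i (x 0 i)].
Proof.
move=> mA.
rewrite (_ : mkset _ = \bigcap_(i in [set: 'I_n]) (rV_coord i @^-1` A i)).
  apply: fin_bigcap_measurable => // i _.
  by rewrite -[X in measurable X]setTI; exact: measurable_rV_coord.
by apply/seteqP; split => x /= h i => [_|]; exact: h.
Qed.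

Lemma lebesgue_rV_box (R : realType) n (A : 'I_n -> set (measurableTypeR R)) :
  (forall i, measurable (A i)) ->
  lebesgue_rV n [set x : 'rV[R]_n | forall i, A i (x 0 i)] =
  (\prod_(i < n) lebesgue_measure (A i))%E.
Proof.
elim: n A => [|n IHn] A mA.
  by rewrite big_ord0 /= diracE mem_set//= => -[].
rewrite big_ord_recl -IHn//= /lebesgue_rV_step /pushforward.
rewrite -product_measure1E//; last first.
  exact: (@measurable_box _ _ (fun i => A (lift ord0 i))).
congr (product_measure1 _ _ _); apply/seteqP; split => -[a v] /= h.
  split; first by have := h 0; rewrite rV_cons0.
  by move=> j; have := h (lift 0 j); rewrite rV_consS.
move=> i; have [j ->|->] := unliftP 0 i; first by rewrite rV_consS; exact: h.2.
by rewrite rV_cons0; exact: h.1.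
Qed.

Definition dotR {R : realType} n (x y : 'rV[R]_n) : R :=
  \sum_(i < n) x 0 i * y 0 i.

(* The norm `|x| of the library on 'rV[R]_n is the sup norm. *)
Definition enorm {R : realType} n (x : 'rV[R]_n) : R := Num.sqrt (dotR x x).

(* Real and imaginary parts are integrated separately, in the Lebesgue sense;
   the integral of a part that is not integrable is a junk value. *)
Definition Cintegral {R : realType} n (f : 'rV[R]_n -> R[i]) : R[i] :=
  (\int[lebesgue_rV n]_x complex.Re (f x)) +i*
  (\int[lebesgue_rV n]_x complex.Im (f x)).

(* expi t = e^{it} *)
Definition expi {R : realType} (t : R) : R[i] := cos t +i* sin t.

Definition fourier {R : realType} n (f : 'rV[R]_n -> R[i]) (xi : 'rV[R]_n) :
    R[i] :=
  Cintegral (fun x => expi (- (2 * pi * dotR xi x)) * f x).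

(* Complex-valued functions on R^n are differentiated componentwise, as
   R[i] carries no normedModType R structure. *)
Definition Cpartial {R : realType} n (i : 'I_n) (f : 'rV[R]_n -> R[i])
    (x : 'rV[R]_n) : R[i] :=
  'D_(delta_mx 0 i) (@complex.Re R \o f) x +i*
  'D_(delta_mx 0 i) (@complex.Im R \o f) x.

(* [:: i1; ...; ik] stands for d/dx_i1 (... (d/dx_ik f)) *)
Definition iter_partial {R : realType} n (a : seq 'I_n)
    (f : 'rV[R]_n -> R[i]) : 'rV[R]_n -> R[i] :=
  foldr (@Cpartial R n) f a.

Definition smooth {R : realType} n (f : 'rV[R]_n -> R[i]) : Prop :=
  forall a : seq 'I_n,
    [/\ continuous (@complex.Re R \o iter_partial a f),
        continuous (@complex.Im R \o iter_partial a f) &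
        forall (i : 'I_n) (x : 'rV[R]_n),
          derivable (@complex.Re R \o iter_partial a f) x (delta_mx 0 i) /\
          derivable (@complex.Im R \o iter_partial a f) x (delta_mx 0 i)].

Definition schwartz {R : realType} n (f : 'rV[R]_n -> R[i]) : Prop :=
  smooth f /\
  forall (a : seq 'I_n) (k : nat), exists M : R, forall x : 'rV[R]_n,
    enorm x ^+ k * Normc.normc (iter_partial a f x) <= M.

(* At y = 0 the integrand is 0 / 0 = 0; {0} is negligible. *)
Definition frac_laplacian {R : realType} n (gamma s : R)
    (u : 'rV[R]_n -> R[i]) (x : 'rV[R]_n) : R[i] :=
  (gamma / 2)%:C *
  Cintegral (fun y => (2 * u x - u (x + y) - u (x - y)) /
                      (enorm y `^ (n%:R + 2 * s))%:C).

(* Main.v *)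
(* Write p = n.+1 + 2 s and M(xi) for the integral of (1 - cos <xi, y>) / |y|^p.
   Integrating the second difference 2 u(x) - u(x + y) - u(x - y) against
   e^{-2 pi i <xi, x>} in x first multiplies the Fourier transform of u by
   2 (1 - cos (2 pi <xi, y>)), so Fubini reduces the theorem to
   M(xi) = |xi|^{2 s} / gamma.  That follows from the normalization of gamma by
   rotation invariance and scaling of Lebesgue measure.
   The integrability needed by Fubini also comes from the normalization: it
   forces min(1, |y|^2) / |y|^p to be integrable, while the second difference of
   a Schwartz function is at most min(1, |y|^2) times integrable functions
   of x. *)
Require Import Defs.
From mathcomp Require Import all_boot all_order all_algebra.
From mathcomp Require Import all_classical all_reals all_analysis.
From mathcomp Require Import measurable_realfun complex ring lra.
Import Order.TTheory GRing.Theory Num.Theory.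
Import numFieldNormedType.Exports.

Set Implicit Arguments.
Unset Strict Implicit.
Unset Printing Implicit Defensive.

Local Open Scope classical_set_scope.
Local Open Scope ring_scope.

(** Lebesgue measure is an iterated product here, so Tonelli's theorem reduces to the line only
    operations that act coordinate by coordinate: translations, dilations, and shears, which
    translate each line parallel to an axis. Rotation invariance is extracted from shears, for
    integrands that depend on y through <xi, y> and |y|^2 alone: rotating y then amounts to rotating
    xi, and it suffices to turn xi onto the last axis. The closed form of M also replaces polar
    coordinates in the integrability question: its values at the frequencies 2^-k e_i are summable
    in k because s > 0. The analysis is carried out over the reals. Cosine and sine of the phase are
    measurable, bounded by 1, and satisfy e(x + y) + e(x - y) = 2 cos <xi, y> e(x). These properties
    carry the Fubini argument, so a single real identity, applied to Re u and Im u with either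
    multiplier, gives the complex one. *)

(** * Translations and dilations of the line *)

Section line.
Context {R : realType}.
Notation lam := (@lebesgue_measure R).

(** Lebesgue measure is determined by its values on the intervals []u, v]], and the preimage of such
    an interval is one of the same length. *)
Lemma lebesgue_measure_shift (b : R) (A : set (measurableTypeR R)) :
  measurable A ->
  pushforward lam (fun x : measurableTypeR R => x + b : measurableTypeR R) A
    = lam A.
Proof.
move=> mA.
have mphi : measurable_fun setT
    (fun x : measurableTypeR R => x + b : measurableTypeR R).
  exact: measurable_funD.
apply/esym/lebesgue_measure_unique => //= _ [[u v]] _ <-.
rewrite /pushforward (_ : _ @^-1` _ = `]u - b, v - b]%classic); last first.
  by apply/seteqP; split=> x /=; rewrite !in_itv/= ltrBlDr lerBrDr.
rewrite !lebesgue_measure_itv/= !lte_fin ltrD2r.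
by case: ifP => // _; rewrite -!EFinB; congr (_%:E); ring.
Qed.

Lemma lebesgue_measure_scale (c : R) (c0 : 0 < c)
    (A : set (measurableTypeR R)) :
  measurable A ->
  (c%:E * pushforward lam
      (fun x : measurableTypeR R => (c * x)%R : measurableTypeR R) A
    = lam A)%E.
Proof.
move=> mA.
have mphi : measurable_fun setT
    (fun x : measurableTypeR R => c * x : measurableTypeR R).
  exact: measurable_funM.
pose m : {measure set (measurableTypeR R) -> \bar R} :=
  mscale (NngNum (ltW c0))
    (measure_function_pushforward__canonical__measure_function_Measure lam mphi).
transitivity (m A) => //; apply/esym/lebesgue_measure_unique => // _ [[u v]] _ <-.
rewrite [RHS](_ : _ = (c%:E * lam `](u / c)%R, (v / c)%R]%classic)%E); last first.
  rewrite /m/= /mscale/= /pushforward; congr (_ * lam _)%E.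
  by apply/seteqP; split=> x /=; rewrite !in_itv/= ltr_pdivrMr// ler_pdivlMr//
    [x * c]mulrC.
rewrite !lebesgue_measure_itv/= !lte_fin ltr_pM2r ?invr_gt0//.
case: ifP => // _; last by rewrite mule0.
by rewrite -!EFinB -EFinM; congr (_%:E); field; rewrite gt_eqF.
Qed.

Lemma ge0_integral_shift (b : R) (f : R -> \bar R) :
  measurable_fun setT f -> (forall x, 0 <= f x)%E ->
  (\int[lam]_x f (x + b)%R = \int[lam]_x f x)%E.
Proof.
move=> mf f0.
have mphi : measurable_fun setT
    (fun x : measurableTypeR R => x + b : measurableTypeR R).
  exact: measurable_funD.
transitivity (\int[pushforward lam
    (fun x : measurableTypeR R => (x + b)%R : measurableTypeR R)]_x f x)%E.
  by rewrite ge0_integral_pushforward.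
apply: eq_measure_integral => A mA _; exact: lebesgue_measure_shift.
Qed.

Lemma ge0_integral_scale (c : R) (f : R -> \bar R) : 0 < c ->
  measurable_fun setT f -> (forall x, 0 <= f x)%E ->
  (c%:E * \int[lam]_x f (c * x)%R = \int[lam]_x f x)%E.
Proof.
move=> c0 mf f0.
have mphi : measurable_fun setT
    (fun x : measurableTypeR R => c * x : measurableTypeR R).
  exact: measurable_funM.
transitivity (c%:E * \int[pushforward lam
    (fun x : measurableTypeR R => (c * x)%R : measurableTypeR R)]_x f x)%E.
  by rewrite ge0_integral_pushforward.
rewrite -[LHS](ge0_integral_mscale
  (measure_function_pushforward__canonical__measure_function_Measure lam mphi)
  measurableT (NngNum (ltW c0)) mf)//.
apply: eq_measure_integral => A mA _; exact: lebesgue_measure_scale.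
Qed.

End line.

(** * Measurability of vector operations, inner product and Euclidean norm *)

Section measurable_rV_ops.
Context d (T : measurableType d) {R : realType} (n : nat).
Implicit Types (f g : T -> 'rV[R]_n) (h : T -> R).

Lemma measurable_rV_coordP f : measurable_fun setT f <->
  forall i, measurable_fun setT (fun t => f t 0 i).
Proof.
split=> [mf i|]; last exact: measurable_fun_rVP.
exact: (measurableT_comp (measurable_rV_coord i) mf).
Qed.

Lemma measurable_rVD f g : measurable_fun setT f -> measurable_fun setT g ->
  measurable_fun setT (fun t => f t + g t).
Proof.
move=> /measurable_rV_coordP mf /measurable_rV_coordP mg.
apply/measurable_rV_coordP => i; under eq_fun do rewrite mxE.
exact: measurable_funD.
Qed.

Lemma measurable_rVZ h f : measurable_fun setT h -> measurable_fun setT f ->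
  measurable_fun setT (fun t => h t *: f t).
Proof.
move=> mh /measurable_rV_coordP mf.
apply/measurable_rV_coordP => i; under eq_fun do rewrite mxE.
exact: measurable_funM.
Qed.

Lemma measurable_rVN f : measurable_fun setT f ->
  measurable_fun setT (fun t => - f t).
Proof.
move=> mf; under eq_fun do rewrite -scaleN1r.
exact: measurable_rVZ.
Qed.

Lemma measurable_rVB f g : measurable_fun setT f -> measurable_fun setT g ->
  measurable_fun setT (fun t => f t - g t).
Proof. by move=> mf mg; apply: measurable_rVD => //; exact: measurable_rVN. Qed.

Lemma measurable_dotR f g : measurable_fun setT f -> measurable_fun setT g ->
  measurable_fun setT (fun t => dotR (f t) (g t)).
Proof.
move=> /measurable_rV_coordP mf /measurable_rV_coordP mg.
apply: measurable_sum => i; exact: measurable_funM.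
Qed.

Lemma measurable_enorm f : measurable_fun setT f ->
  measurable_fun setT (fun t => enorm (f t)).
Proof.
move=> mf; apply: (measurableT_comp (continuous_measurable_fun (@sqrt_continuous R))).
exact: measurable_dotR.
Qed.

End measurable_rV_ops.

(** * Linear operations and the splitting of the first coordinate *)

Section cons_ops.
Context {R : realType} (n : nat).

Lemma rV_consD (p q : measurableTypeR R * 'rV[R]_n) :
  rV_cons p + rV_cons q = rV_cons (p.1 + q.1, p.2 + q.2).
Proof.
apply/rowP => i; rewrite mxE; have [j ->|->] := unliftP 0 i.
  by rewrite !rV_consS mxE.
by rewrite !rV_cons0.
Qed.

Lemma rV_consZ (c : R) (p : measurableTypeR R * 'rV[R]_n) :
  c *: rV_cons p = rV_cons (c * p.1, c *: p.2).
Proof.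
apply/rowP => i; rewrite mxE; have [j ->|->] := unliftP 0 i.
  by rewrite !rV_consS mxE.
by rewrite !rV_cons0.
Qed.

Lemma rV_cons_delta0 (t : R) :
  t *: delta_mx 0 0 = rV_cons (t, 0 : 'rV[R]_n).
Proof.
apply/rowP => i; rewrite [LHS]mxE [delta_mx _ _ _ _]mxE.
have [j ->|->] := unliftP 0 i.
  by rewrite !rV_consS mxE mulr0.
by rewrite !rV_cons0 mulr1.
Qed.

Lemma rV_cons_deltaS (t : R) j :
  t *: delta_mx 0 (lift 0 j) = rV_cons (0, t *: delta_mx 0 j : 'rV[R]_n).
Proof.
apply/rowP => i; rewrite [LHS]mxE [delta_mx _ _ _ _]mxE.
have [k ->|->] := unliftP 0 i.
  by rewrite !rV_consS !mxE /= (inj_eq lift_inj).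
by rewrite !rV_cons0 mulr0.
Qed.

End cons_ops.

(** * Tonelli on R^n; invariance under shears, translations and dilations *)

Section integral_rV.
Context {R : realType}.
Notation lam := (@lebesgue_measure R).
Local Notation mu n := (@lebesgue_rV R n).

Lemma measurable_rV_consr n (a : R) :
  measurable_fun setT (fun v : 'rV[R]_n => rV_cons (a, v)).
Proof. exact: (measurableT_comp (@measurable_rV_cons R n)). Qed.

Lemma measurable_rV_consl n (v : 'rV[R]_n) :
  measurable_fun setT (fun a : measurableTypeR R => rV_cons (a, v)).
Proof. exact: (measurableT_comp (@measurable_rV_cons R n)). Qed.

Section tonelli.
Variables (n : nat) (f : 'rV[R]_n.+1 -> \bar R).
Hypotheses (mf : measurable_fun setT f) (f0 : forall x, (0 <= f x)%E).

Let mfc : measurable_fun setT (f \o @rV_cons R n).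
Proof. exact: measurableT_comp mf (@measurable_rV_cons R n). Qed.

Lemma ge0_integral_rV_prod :
  (\int[mu n.+1]_x f x = \int[lam \x mu n]_p f (rV_cons p))%E.
Proof.
transitivity (\int[pushforward (lam \x mu n)%E (@rV_cons R n)]_x f x)%E.
  by [].
by rewrite ge0_integral_pushforward//; exact: measurable_rV_cons.
Qed.

Lemma ge0_integral_rV_cons :
  (\int[mu n.+1]_x f x = \int[lam]_a \int[mu n]_v f (rV_cons (a, v)))%E.
Proof.
by rewrite ge0_integral_rV_prod (fubini_tonelli1 (f \o @rV_cons R n))//=.
Qed.

(** This order, with the first coordinate innermost, serves a shear that moves the first coordinate
    by an amount depending on the others. *)
Lemma ge0_integral_rV_rcons :
  (\int[mu n.+1]_x f x = \int[mu n]_v \int[lam]_a f (rV_cons (a, v)))%E.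
Proof.
by rewrite ge0_integral_rV_prod (fubini_tonelli2 (f \o @rV_cons R n))//=.
Qed.

Lemma measurable_integral_rV_cons :
  measurable_fun setT (fun a : measurableTypeR R =>
    \int[mu n]_v f (rV_cons (a, v)))%E.
Proof.
by apply: (measurable_fun_fubini_tonelli_F (f \o @rV_cons R n)) => /= *.
Qed.

End tonelli.

(** Since [h] is constant along the i-th axis, the map is a translation on each line parallel to
    that axis. The induction peels off coordinates until the i-th one comes first. *)
Lemma ge0_integral_shear n (i : 'I_n) (h : 'rV[R]_n -> R)
    (f : 'rV[R]_n -> \bar R) :
  measurable_fun setT h -> (forall x t, h (x + t *: delta_mx 0 i) = h x) ->
  measurable_fun setT f -> (forall x, 0 <= f x)%E ->
  (\int[mu n]_x f (x + h x *: delta_mx 0 i)%R = \int[mu n]_x f x)%E.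
Proof.
elim: n i h f => [[]//|n IHn] i h f mh hi mf f0.
have mg : measurable_fun setT
    (fun x : 'rV[R]_n.+1 => f (x + h x *: delta_mx 0 i)%R).
  apply: measurableT_comp => //; apply: measurable_rVD => //.
  exact: measurable_rVZ.
have [j ij|i0] := unliftP 0 i; last first.
  rewrite (ge0_integral_rV_rcons mg (fun=> f0 _)) (ge0_integral_rV_rcons mf f0).
  apply: eq_integral => v _.
  rewrite -[RHS](@ge0_integral_shift _ (h (rV_cons (0, v)))); last 2 first.
  - by apply: measurableT_comp => //; exact: measurable_rV_consl.
  - by move=> a; exact: f0.
  apply: eq_integral => a _.
  rewrite i0 (_ : h (rV_cons (a, v)) = h (rV_cons (0, v))); last first.
    rewrite -(hi (rV_cons (0, v)) a) i0 rV_cons_delta0 rV_consD/=.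
    by rewrite add0r addr0.
  by rewrite rV_cons_delta0 rV_consD/= addr0.
rewrite (ge0_integral_rV_cons mg (fun=> f0 _)) (ge0_integral_rV_cons mf f0).
apply: eq_integral => a _.
rewrite -[RHS](IHn j (fun v => h (rV_cons (a, v))))//.
- apply: eq_integral => v _.
  by rewrite ij rV_cons_deltaS rV_consD/= addr0.
- by apply: measurableT_comp => //; exact: measurable_rV_consr.
- move=> x t; rewrite -[RHS](hi _ t) ij rV_cons_deltaS rV_consD/=.
  by rewrite addr0.
- by apply: measurableT_comp => //; exact: measurable_rV_consr.
Qed.

Lemma ge0_integral_translate n (y : 'rV[R]_n) (f : 'rV[R]_n -> \bar R) :
  measurable_fun setT f -> (forall x, 0 <= f x)%E ->
  (\int[mu n]_x f (x + y)%R = \int[mu n]_x f x)%E.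
Proof.
elim: n y f => [|n IHn] y f mf f0.
  by apply: eq_integral => x _; congr f; apply/rowP => -[].
have mg : measurable_fun setT (fun x : 'rV[R]_n.+1 => f (x + y)%R).
  by apply: measurableT_comp => //; exact: measurable_rVD.
rewrite (ge0_integral_rV_cons mg (fun=> f0 _)) (ge0_integral_rV_cons mf f0).
rewrite -(rV_unconsK y); case: (rV_uncons y) => b w.
rewrite -[RHS](@ge0_integral_shift _ b); last 2 first.
- exact: measurable_integral_rV_cons.
- by move=> a; exact: integral_ge0.
apply: eq_integral => a _; rewrite -[RHS](IHn w)//.
  by apply: eq_integral => v _; rewrite rV_consD.
by apply: measurableT_comp => //; exact: measurable_rV_consr.
Qed.

Lemma ge0_integral_dilate n (c : R) (f : 'rV[R]_n -> \bar R) : 0 < c ->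
  measurable_fun setT f -> (forall x, 0 <= f x)%E ->
  ((c ^+ n)%:E * \int[mu n]_x f (c *: x)%R = \int[mu n]_x f x)%E.
Proof.
move=> c0; elim: n f => [|n IHn] f mf f0.
  by rewrite expr0 mul1e; apply: eq_integral => x _; congr f; apply/rowP => -[].
have mg : measurable_fun setT (fun x : 'rV[R]_n.+1 => f (c *: x)%R).
  by apply: measurableT_comp => //; exact: measurable_rVZ.
have mfc (a : R) : measurable_fun setT (fun v => f (rV_cons (a, v))).
  by apply: measurableT_comp => //; exact: measurable_rV_consr.
rewrite (ge0_integral_rV_cons mg (fun=> f0 _)) (ge0_integral_rV_cons mf f0).
rewrite -[RHS](ge0_integral_scale c0); last 2 first.
- exact: measurable_integral_rV_cons.
- by move=> a; exact: integral_ge0.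
rewrite exprS EFinM -muleA; congr (_ * _)%E.
rewrite -ge0_integralZl; last 4 first.
- exact: measurableT.
- exact: (measurable_integral_rV_cons mg).
- by move=> a _; exact: integral_ge0.
- by rewrite lee_fin exprn_ge0// ltW.
apply: eq_integral => a _; rewrite -(IHn (fun v => f (rV_cons (c * a, v))))//.
by congr (_ * _)%E; apply: eq_integral => v _; rewrite rV_consZ.
Qed.

End integral_rV.

(** * Inner product and Euclidean norm *)

Section dotR_theory.
Context {R : realType} (n : nat).
Implicit Types x y z : 'rV[R]_n.

Lemma dotRC x y : dotR x y = dotR y x.
Proof. by apply: eq_bigr => i _; rewrite mulrC. Qed.

Lemma dotRDr x y z : dotR x (y + z) = dotR x y + dotR x z.
Proof. by rewrite -big_split/=; apply: eq_bigr => i _; rewrite mxE mulrDr. Qed.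

Lemma dotRDl x y z : dotR (y + z) x = dotR y x + dotR z x.
Proof. by rewrite dotRC dotRDr !(dotRC x). Qed.

Lemma dotRZr c x y : dotR x (c *: y) = c * dotR x y.
Proof. by rewrite mulr_sumr; apply: eq_bigr => i _; rewrite mxE mulrCA. Qed.

Lemma dotRZl c x y : dotR (c *: y) x = c * dotR y x.
Proof. by rewrite dotRC dotRZr dotRC. Qed.

Lemma dotRNr x y : dotR x (- y) = - dotR x y.
Proof. by rewrite -scaleN1r dotRZr mulN1r. Qed.

Lemma dotR_deltar x i : dotR x (delta_mx 0 i) = x 0 i.
Proof.
rewrite /dotR (bigD1 i)//= mxE !eqxx mulr1 big1 ?addr0// => j ji.
by rewrite mxE (negPf ji) andbF mulr0.
Qed.

Lemma dotR_deltal x i : dotR (delta_mx 0 i) x = x 0 i.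
Proof. by rewrite dotRC dotR_deltar. Qed.

Lemma dotRxx_ge0 x : 0 <= dotR x x.
Proof. by apply: sumr_ge0 => i _; rewrite -expr2 sqr_ge0. Qed.

Lemma enorm_ge0 x : 0 <= enorm x. Proof. exact: sqrtr_ge0. Qed.

Lemma enormZ c x : enorm (c *: x) = `|c| * enorm x.
Proof.
by rewrite /enorm dotRZl dotRZr mulrA -expr2 sqrtrM ?sqr_ge0// sqrtr_sqr.
Qed.

End dotR_theory.

(** * Rotation invariance from shears *)

Section rotation.
Context {R : realType} (n : nat).
Local Notation mu := (@lebesgue_rV R n).
Variable F : R * R -> \bar R.
Hypotheses (mF : measurable_fun setT F) (F0 : forall p, (0 <= F p)%E).
Hypothesis FN : forall a b, F (- a, b) = F (a, b).

Let H (xi : 'rV[R]_n) : \bar R := (\int[mu]_y F (dotR xi y, dotR y y))%E.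

Let mFdot (xi : 'rV[R]_n) :
  measurable_fun setT (fun y : 'rV[R]_n => F (dotR xi y, dotR y y)).
Proof.
apply: measurableT_comp => //; apply/measurable_fun_pairP; split => /=.
- exact: measurable_dotR.
- exact: measurable_dotR.
Qed.

Let shear (i j : 'I_n) (c : R) (x : 'rV[R]_n) : 'rV[R]_n :=
  x + (c * x 0 j) *: delta_mx 0 i.

Let shear_coord (i j : 'I_n) c x : i != j -> shear i j c x 0 j = x 0 j.
Proof. by move=> ij; rewrite !mxE eq_sym (negPf ij) andbF mulr0 addr0. Qed.

Let shear_self (i j : 'I_n) c x : shear i j c x 0 i = x 0 i + c * x 0 j.
Proof. by rewrite !mxE !eqxx mulr1. Qed.

Let dotR_shear k l c x z : dotR x (shear k l c z) = dotR x z + c * z 0 l * x 0 k.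
Proof. by rewrite dotRDr dotRZr dotR_deltar. Qed.

Let dotR_shear2 k l c z : dotR (shear k l c z) (shear k l c z) =
  dotR z z + c * z 0 l * z 0 k *+ 2 + (c * z 0 l) ^+ 2.
Proof. by rewrite dotR_shear dotRC dotR_shear shear_self; ring. Qed.

Let mshear (i j : 'I_n) c : measurable_fun setT (shear i j c).
Proof.
apply: measurable_rVD => //; apply: measurable_rVZ => //.
by apply: measurable_funM => //; exact: (measurable_rV_coord j).
Qed.

Let integral_shear (i j : 'I_n) c (f : 'rV[R]_n -> \bar R) : i != j ->
  measurable_fun setT f -> (forall x, 0 <= f x)%E ->
  (\int[mu]_x f (shear i j c x) = \int[mu]_x f x)%E.
Proof.
move=> ij mf f0.
apply: (@ge0_integral_shear _ _ i (fun x => c * x 0 j)) => //.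
  by apply: measurable_funM => //; exact: (measurable_rV_coord j).
by move=> x t; rewrite !mxE eq_sym (negPf ij) andbF mulr0 addr0.
Qed.

(* A plane rotation of angle other than pi is a product of three shears. *)
Let rotate_coord (i j : 'I_n) (xi : 'rV[R]_n) : i != j -> xi 0 i != 0 ->
  let r := Num.sqrt (xi 0 i ^+ 2 + xi 0 j ^+ 2) in
  H xi = H (xi - xi 0 i *: delta_mx 0 i + (r - xi 0 j) *: delta_mx 0 j).
Proof.
move=> ij xi0 r; set a := xi 0 i in xi0 r *; set b := xi 0 j in r *.
have r2 : r ^+ 2 = a ^+ 2 + b ^+ 2 by rewrite sqr_sqrtr// addr_ge0// sqr_ge0.
have r0 : r != 0.
  by rewrite -sqrf_eq0 r2 paddr_eq0 ?sqr_ge0// negb_and sqrf_eq0 xi0.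
have ji : j != i by rewrite eq_sym.
(* Writing b = r cos(alpha) and a = r sin(alpha), these are t = tan(alpha / 2) and u = - sin(alpha).
   The transpose of the resulting rotation sends the coordinates (a, b) of [xi] to (0, r); [a != 0]
   keeps alpha away from pi. *)
pose t := (r - b) / a; pose u := - (a / r).
pose f (y : 'rV[R]_n) := F (dotR xi y, dotR y y).
have mf : measurable_fun setT f by exact: mFdot.
have mf1 : measurable_fun setT (f \o shear i j t) by exact: measurableT_comp.
have mf2 : measurable_fun setT (f \o shear i j t \o shear j i u).
  exact: (measurableT_comp mf1).
transitivity (\int[mu]_y (f \o shear i j t \o shear j i u \o shear i j t) y)%E.
  apply/esym; apply: etrans (integral_shear t ij mf2 _) _ => [x|].
    exact: F0.
  apply: etrans (integral_shear u ji mf1 _) _ => [x|]; first exact: F0.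
  by apply: integral_shear => // x; exact: F0.
rewrite {mf mf1 mf2}/f /=.
apply: eq_integral => y _.
set y1 := shear i j t y; set y2 := shear j i u y1.
have y1i : y1 0 i = y 0 i + t * y 0 j by exact: shear_self.
have y1j : y1 0 j = y 0 j by exact: shear_coord.
have y2i : y2 0 i = y1 0 i by exact: shear_coord.
have y2j : y2 0 j = y 0 j + u * y1 0 i by rewrite -y1j; exact: shear_self.
congr (F (_, _)).
  rewrite !dotR_shear y2j y1i -/a -/b -scaleN1r scalerA.
  rewrite !dotRDl !dotRZl !dotR_deltal /t /u; field.
  by rewrite xi0 r0.
(* The half-angle formula for the sine. The change of |y|^2 under the three shears is a multiple of
   this expression. *)
have ut : u * (1 + t ^+ 2) + t *+ 2 = 0.
  have -> : u * (1 + t ^+ 2) + t *+ 2 =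
      (r ^+ 2 - a ^+ 2 - b ^+ 2) / (a * r) by rewrite /u /t; field; rewrite xi0 r0.
  by rewrite r2; ring.
rewrite !dotR_shear2 y2i y2j y1j; set p := y1 0 i in y1i *.
have -> : y 0 i = p - t * y 0 j by rewrite y1i addrK.
transitivity (dotR y y +
    (u * p ^+ 2 + p * y 0 j *+ 2) * (u * (1 + t ^+ 2) + t *+ 2)).
  by ring.
by rewrite ut mulr0 addr0.
Qed.

(** Givens elimination: a rotation in the plane (i, l) clears coordinate i into coordinate l,
    keeping the norm and the zeros already produced. *)
Let integral_dot_last_aux (l : 'I_n) (s : seq 'I_n) (xi : 'rV[R]_n) :
  l \notin s -> exists xi' : 'rV[R]_n,
  [/\ dotR xi' xi' = dotR xi xi, (forall i, i \in s -> xi' 0 i = 0) &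
      H xi' = H xi].
Proof.
elim: s xi => [|i s IHs] xi; first by exists xi.
rewrite inE negb_or => /andP[li ls].
have il : i != l by rewrite eq_sym.
have [xi1 [d1 z1 H1]] := IHs xi ls.
have [xi10|xi10] := eqVneq (xi1 0 i) 0.
  by exists xi1; split=> // k; rewrite inE => /predU1P[->//|]; exact: z1.
have := rotate_coord il xi10; set r := Num.sqrt _ => /= Hr.
have r2 : r ^+ 2 = xi1 0 i ^+ 2 + xi1 0 l ^+ 2.
  by rewrite sqr_sqrtr// addr_ge0// sqr_ge0.
exists (xi1 - xi1 0 i *: delta_mx 0 i + (r - xi1 0 l) *: delta_mx 0 l).
split; last by rewrite -Hr H1.
- rewrite -d1 -scaleN1r scalerA !(dotRDl, dotRDr, dotRZl, dotRZr).
  rewrite !(dotR_deltal, dotR_deltar) !mxE !eqxx  ?(negPf il) ?(negPf li)/=.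
  by transitivity (dotR xi1 xi1 + (r ^+ 2 - (xi1 0 i ^+ 2 + xi1 0 l ^+ 2)));
    [ring | rewrite r2 subrr addr0].
- move=> k; rewrite inE => /predU1P[->|ks].
    by rewrite !mxE !eqxx (negPf il)/= mulr1 mulr0 addr0 subrr.
  rewrite !mxE (z1 k ks) (_ : (k == l) = false); last first.
    by apply: contraNF ls => /eqP <-.
  rewrite /= mulr0 addr0 sub0r.
  have [ki|] := eqVneq k i; last by rewrite mulr0 oppr0.
  by rewrite -ki (z1 k ks) mul0r oppr0.
Qed.

(** Clearing every coordinate except l leaves [xi] equal to plus or minus |xi| e_l; the evenness
    [FN] absorbs the sign. *)
Lemma ge0_integral_dot_radial (l : 'I_n) (xi : 'rV[R]_n) :
  (\int[mu]_y F (dotR xi y, dotR y y) =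
   \int[mu]_y F ((enorm xi * y 0 l)%R, dotR y y))%E.
Proof.
have [xi' [d z Hxi]] := @integral_dot_last_aux l [seq i <- enum 'I_n | i != l] xi
  ltac:(by rewrite mem_filter eqxx).
have xiE : xi' = xi' 0 l *: delta_mx 0 l.
  apply/rowP => i; rewrite !mxE eqxx/=; have [->|il] := eqVneq i l.
    by rewrite mulr1.
  by rewrite mulr0; apply: z; rewrite mem_filter il mem_enum.
have nxi : enorm xi = `|xi' 0 l|.
  rewrite /enorm -d -sqrtr_sqr {1 2}xiE dotRZl dotRZr dotR_deltal.
  by rewrite mxE !eqxx mulr1.
rewrite -/(H xi) -Hxi /H; apply: eq_integral => y _.
rewrite xiE dotRZl dotR_deltal nxi.
by have [_|_] := ger0P (xi' 0 l); rewrite ?mulNr ?FN.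
Qed.

End rotation.

(** * Lower bounds for 1 - cos *)

Section one_minus_cos.
Context {R : realType}.

Lemma one_minus_cos_ge0 (t : R) : 0 <= 1 - cos t.
Proof. by rewrite subr_ge0 cos_le1. Qed.

Lemma one_minus_cos_sin2 (t : R) : 1 - cos t = 2 * sin (t / 2) ^+ 2.
Proof.
rewrite {1}(_ : t = (t / 2) *+ 2) ?cos_mulr2n; last by field.
rewrite -mulr_natl; have := cos2Dsin2 (t / 2); lra.
Qed.

(** Mean value theorem, with [cos] decreasing on [0, 1]. *)
Lemma sin_ge_cos1 (t : R) : 0 <= t <= 1 -> cos 1 * t <= sin t.
Proof.
move=> /andP[t0 t1].
have [c ct] : exists2 c, c \in `[0, t] & sin t - sin 0 = cos c * (t - 0).
  apply: MVT_segment => //.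
  by apply: continuous_subspaceT; exact: continuous_sin.
rewrite sin0 !subr0 => ->; apply: ler_wpM2r => //.
move: ct; rewrite in_itv/= => /andP[c0 ct].
have pi1 : 1 <= pi :> R by rewrite (le_trans _ (pi_ge2 R))// ler1n.
have [->//|cn1] := eqVneq c 1.
rewrite ltW// ltr_cos ?in_itv/= ?ler01 ?c0//=.
- by rewrite lt_neqAle cn1 (le_trans ct).
- by rewrite (le_trans ct)// (le_trans t1).
Qed.

(** Comes from 1 - cos t = 2 sin(t / 2)^2 and |sin(t / 2)| >= cos 1 * |t| / 2 for |t| <= 2. *)
Local Notation c1 := (cos (1 : R) ^+ 2 / 2).

Lemma one_minus_cos_ge (t : R) : `|t| <= 2 -> c1 * t ^+ 2 <= 1 - cos t.
Proof.
move=> t2; rewrite -(cos_norm t) -[t ^+ 2]real_normK ?num_real//.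
rewrite one_minus_cos_sin2; set u := `|t| in t2 *.
have u0 : 0 <= u by exact: normr_ge0.
have /sin_ge_cos1 h : 0 <= u / 2 <= 1 by lra.
have h0 : 0 <= cos 1 * (u / 2) by rewrite mulr_ge0 ?divr_ge0// ltW// cos1_gt0.
have : (cos 1 * (u / 2)) ^+ 2 <= sin (u / 2) ^+ 2.
  by rewrite lerXn2r ?nnegrE// (le_trans h0).
rewrite exprMn => hs.
have -> : c1 * u ^+ 2 = 2 * (cos 1 ^+ 2 * (u / 2) ^+ 2) by field.
by rewrite ler_wpM2l.
Qed.

(** A fixed frequency misses the multiples of its period. If |t| > 2, the first k with 2^-k |t| <= 2
    leaves this number above 1, where the quadratic lower bound is at least [c1]; if |t| <= 2, k = 0
    works. *)
Lemma dyadic_one_minus_cos (t : R) :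
  exists k, c1 * Num.min 1 (t ^+ 2) <= 1 - cos (2^-1 ^+ k * t).
Proof.
have c10 : 0 <= c1 by rewrite divr_ge0// sqr_ge0.
have [t2|t2] := leP `|t| 2.
  exists 0; rewrite expr0 mul1r (le_trans _ (one_minus_cos_ge t2))//.
  by rewrite ler_wpM2l// ge_min lexx orbT.
have [m tm] : exists m, `|t| < m%:R.
  by exists (Num.bound `|t|); rewrite archi_boundP.
have ex : exists k, 2^-1 ^+ k * `|t| <= 2.
  exists m; rewrite exprVn mulrC ler_pdivrMr ?exprn_gt0//.
  rewrite (le_trans (ltW tm))// (@le_trans _ _ (2 ^+ m))//; last first.
    by rewrite ler_peMl ?exprn_ge0// ler1n.
  by rewrite -natrX ler_nat ltnW// ltn_expl.
have := ex_minnP ex => -[[|k] hk mink].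
  by move: hk; rewrite expr0 mul1r leNgt t2.
have k2 : 2 < 2^-1 ^+ k * `|t|.
  by rewrite ltNge; apply/negP => /mink; rewrite ltnn.
exists k.+1; set u := 2^-1 ^+ k.+1 * t.
have nu : `|u| = 2^-1 ^+ k.+1 * `|t| by rewrite normrM ger0_norm// exprn_ge0.
have /one_minus_cos_ge : `|u| <= 2 by rewrite nu.
apply: le_trans; rewrite ler_wpM2l// ge_min; apply/orP; left.
rewrite -real_normK ?num_real// exprn_ege1// nu exprS -mulrA.
by move: k2; set w := _ * `|t| => k2; lra.
Qed.

End one_minus_cos.

(** * The singular kernel: exact cosine integrals and integrability *)

Section kernel.
Context {R : realType} (n : nat) (s gamma : R).
Local Notation mu := (@lebesgue_rV R n.+1).
Local Notation p := (n.+1%:R + 2 * s).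
Hypotheses (s_gt0 : 0 < s) (gamma_gt0 : 0 < gamma).
Hypothesis gammaE : (gamma%:E * \int[mu]_z
  ((1 - cos (z 0 ord_max)) / enorm z `^ p)%:E = 1)%E.

Lemma measurable_enorm_powRV :
  measurable_fun setT (fun y : 'rV[R]_n.+1 => (enorm y `^ p)^-1).
Proof.
under [X in measurable_fun _ X]eq_fun do rewrite -powRN.
apply: (measurableT_comp (measurable_powR (- p))).
exact: measurable_enorm.
Qed.

Lemma enorm_powRV_ge0 (y : 'rV[R]_n.+1) : 0 <= (enorm y `^ p)^-1.
Proof. by rewrite invr_ge0 powR_ge0. Qed.

(** The integral is a priori an extended real; that its product with [gamma] is 1 makes it
    finite. *)
Let base_integral : (\int[mu]_z
  ((1 - cos (z 0 ord_max)) / enorm z `^ p)%:E = (gamma^-1)%:E)%E.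
Proof.
have := gammaE; set I := (\int[_]_z _)%E => gE.
rewrite -[LHS]mul1e (_ : 1 = gamma^-1 * gamma); last by rewrite mulVf// gt_eqF.
by rewrite EFinM -muleA gE mule1.
Qed.

Lemma integral_one_minus_cos_kernel (xi : 'rV[R]_n.+1) :
  (\int[mu]_y ((1 - cos (dotR xi y)) / enorm y `^ p)%:E =
   (enorm xi `^ (2 * s) / gamma)%:E)%E.
Proof.
pose F (q : R * R) := ((1 - cos q.1) / Num.sqrt q.2 `^ p)%:E.
have mF : measurable_fun setT F.
  apply/measurable_EFinP; apply: measurable_funM.
    apply: measurable_funB => //.
    apply: (measurableT_comp (continuous_measurable_fun (@continuous_cos R))).
    exact: measurable_fst.
  under [X in measurable_fun _ X]eq_fun do rewrite -powRN.
  apply: (measurableT_comp (measurable_powR (- p))).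
  apply: (measurableT_comp (continuous_measurable_fun (@sqrt_continuous R))).
  exact: measurable_snd.
have F0 q : (0 <= F q)%E.
  by rewrite lee_fin divr_ge0 ?one_minus_cos_ge0 ?powR_ge0.
have FN a b : F (- a, b) = F (a, b) by rewrite /F/= cosN.
transitivity (\int[mu]_y F (dotR xi y, dotR y y))%E; first by [].
rewrite (ge0_integral_dot_radial mF F0 FN ord_max).
(* A dilation needs a positive factor, so [xi = 0] is separate: both sides vanish there, the right
   one because 2 s is nonzero. *)
set c := enorm xi; have [c0|c0] := eqVneq c 0.
  rewrite c0 powR0 ?mulf_neq0 ?gt_eqF// mul0r.
  by apply: integral0_eq => y _; rewrite /F/= mul0r cos0 subrr mul0r.
have {}c0 : 0 < c by rewrite lt_def c0 enorm_ge0.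
have cp k : c `^ k != 0 by rewrite gt_eqF// powR_gt0.
pose f (y : 'rV[R]_n.+1) := ((1 - cos (y 0 ord_max)) / enorm y `^ p)%:E.
have mf : measurable_fun setT f.
  apply/measurable_EFinP; apply: measurable_funM;
    last exact: measurable_enorm_powRV.
  apply: measurable_funB => //.
  apply: (measurableT_comp (continuous_measurable_fun (@continuous_cos R))).
  exact: (measurable_rV_coord ord_max).
have f0 y : (0 <= f y)%E.
  by rewrite lee_fin divr_ge0 ?one_minus_cos_ge0 ?powR_ge0.
have /= base := ge0_integral_dilate c0 mf f0.
rewrite EFinM -base_integral -[RHS]/((c `^ (2 * s))%:E * \int[mu]_z f z)%E -base.
(* Homogeneity of the kernel gives the power p and the dilation uses up n.+1 of it, which leaves the
   exponent 2 s. *)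
transitivity ((c `^ p)%:E * \int[mu]_y f (c *: y))%E.
  rewrite -ge0_integralZl; last 4 first.
  - exact: measurableT.
  - by apply: measurableT_comp => //; exact: measurable_rVZ.
  - by move=> y _; exact: f0.
  - by rewrite lee_fin powR_ge0.
  apply: eq_integral => y _.
  rewrite /F /f/= -EFinM mxE enormZ ger0_norm ?enorm_ge0//.
  rewrite powRM ?enorm_ge0// ?(ltW c0)// -/(enorm y); congr (_%:E).
  by rewrite invfM [RHS]mulrCA mulVKf.
rewrite muleA -EFinM; congr ((_)%:E * _)%E.
rewrite (@powRD _ c n.+1%:R (2 * s)) ?(gt_eqF c0) ?implybT// mulrC.
by rewrite powR_mulrn// ltW.
Qed.

(* Some dyadic frequency 2^-k detects min(1, t^2), and the integrals of
   (1 - cos (2^-k y_i)) / |y|^p are, up to 1 / gamma, the powers of 2^(-2 s):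
   their sum over k is finite. *)
Lemma integral_min_kernel_lty (i : 'I_n.+1) :
  (\int[mu]_y (Num.min 1 (y 0 i ^+ 2) / enorm y `^ p)%:E < +oo)%E.
Proof.
pose c1 : R := cos 1 ^+ 2 / 2.
have c1_gt0 : 0 < c1 by rewrite divr_gt0// exprn_gt0// cos1_gt0.
pose f k (y : 'rV[R]_n.+1) :=
  ((1 - cos (dotR (2^-1 ^+ k *: delta_mx 0 i) y)) / enorm y `^ p)%:E.
have mf k : measurable_fun setT (f k).
  apply/measurable_EFinP; apply: measurable_funM;
    last exact: measurable_enorm_powRV.
  apply: measurable_funB => //.
  apply: (measurableT_comp (continuous_measurable_fun (@continuous_cos R))).
  exact: measurable_dotR.
have f0 k y : (0 <= f k y)%E.
  by rewrite lee_fin divr_ge0 ?one_minus_cos_ge0 ?powR_ge0.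
pose r : R := 2^-1 `^ (2 * s).
have r0 : 0 < r by rewrite powR_gt0// invr_gt0.
have r1 : r < 1.
  have := @gt0_ltr_powR R (2 * s) _ 2^-1 1; rewrite powR1/=.
  by apply; rewrite ?nnegrE ?invr_ge0 ?invf_lt1 ?ltr1n ?mulr_gt0.
have fE k : (\int[mu]_y f k y = (gamma^-1 * r ^+ k)%:E)%E.
  rewrite integral_one_minus_cos_kernel enormZ /enorm dotR_deltal mxE !eqxx.
  rewrite sqrtr1 mulr1 ger0_norm ?exprn_ge0// mulrC; congr (_ * _)%:E.
  have h2 : 0 <= 2^-1 :> R by rewrite invr_ge0.
  by rewrite -(powR_mulrn k h2) -(powR_mulrn k (powR_ge0 _ _)) powRAC.
have sumE : (\int[mu]_y (\sum_(k <oo) f k y) <= (gamma^-1 * (1 - r)^-1)%:E)%E.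
  rewrite integral_nneseries//; apply: lime_le.
    apply: is_cvg_nneseries => k _ _.
    by rewrite fE lee_fin mulr_ge0 ?invr_ge0 ?exprn_ge0 ?ltW.
  apply: nearW => m; under eq_bigr do rewrite fE.
  rewrite sumEFin lee_fin.
  have := @geometric_le_lim R m gamma^-1 r.
  rewrite /series/= invr_ge0 (ltW gamma_gt0) ger0_norm; last exact: ltW.
  exact.
have mg : measurable_fun setT (fun y : 'rV[R]_n.+1 =>
    (Num.min 1 (y 0 i ^+ 2) / enorm y `^ p)%:E).
  apply/measurable_EFinP; apply: measurable_funM;
    last exact: measurable_enorm_powRV.
  apply: measurable_minr => //; apply: measurable_funX.
  exact: (measurable_rV_coord i).
have g0 (y : 'rV[R]_n.+1) : (0 <= (Num.min 1 (y 0 i ^+ 2) / enorm y `^ p)%:E)%E.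
  by rewrite lee_fin divr_ge0 ?powR_ge0// le_min ler01 sqr_ge0.
have ms : measurable_fun setT (fun y => \sum_(k <oo) f k y)%E.
  exact: ge0_emeasurable_sum.
have s0 y : (0 <= \sum_(k <oo) f k y)%E by exact: nneseries_ge0.
have ci : (0 <= (c1^-1)%:E)%E by rewrite lee_fin invr_ge0 ltW.
(* At each y a single term of the series, with k depending on y, already gives the bound; summing
   over k makes the majorant independent of that choice. *)
apply: (@le_lt_trans _ _ (\int[mu]_y ((c1^-1)%:E * \sum_(k <oo) f k y))%E);
  last first.
  rewrite ge0_integralZl//.
  by apply: le_lt_trans (lee_wpmul2l ci sumE) _; rewrite -EFinM ltry.
apply: ge0_le_integral => //.
  exact: measurable_funeM.
move=> y _; have [k hk] := dyadic_one_minus_cos (y 0 i).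
have fk : (f k y <= \sum_(k <oo) f k y)%E.
  apply: le_trans (@nneseries_lim_ge _ (f ^~ y) xpredT 0 k.+1 _) => //.
  rewrite big_nat_recr//= -[X in (X <= _)%E]add0e; apply: leeD => //.
  by apply: sume_ge0.
apply: le_trans (lee_wpmul2l ci fk).
rewrite /f -EFinM lee_fin dotRZl dotR_deltal mulrA.
rewrite ler_wpM2r ?enorm_powRV_ge0//.
by rewrite ler_pdivlMl.
Qed.

End kernel.

(** * Continuous functions on R^n are measurable *)

Section continuous_measurable_rV.
Context {R : realType} (n : nat).

Lemma cvg_rV (u : nat -> 'rV[R]_n) (x : 'rV[R]_n) :
  (forall j, (fun k => u k 0 j) @ \oo --> x 0 j) -> u @ \oo --> x.
Proof.
move=> ux A [B xB sBA].
suff : \forall k \near \oo, forall i j, B i j (u k i j).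
  by apply: filterS => k Bk; exact: sBA.
apply: filter_forall => i; apply: filter_forall => j.
by rewrite (ord1 i); apply: ux; have := xB 0 j.
Qed.

(* f is the limit of its step approximations on the grids of mesh 1 / (k + 1). *)
Lemma continuous_measurable_rV (f : 'rV[R]_n -> R) :
  continuous f -> measurable_fun setT f.
Proof.
move=> cf.
pose z k (x : 'rV[R]_n) : 'rV[int]_n := \row_j Num.floor (k.+1%:R * x 0 j).
pose h k (w : 'rV[int]_n) : 'rV[R]_n := \row_j ((w 0 j)%:~R / k.+1%:R).
apply: (@measurable_fun_cvg _ _ R setT (fun k => f \o h k \o z k)); last first.
  move=> x _; suff zx : (fun k => h k (z k x)) @ \oo --> x.
    exact: cvg_comp zx (cf x).
  apply: cvg_rV => j; apply/cvgrPdist_lt => e e0.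
  near=> k; rewrite !mxE.
  apply: (@le_lt_trans _ _ k.+1%:R^-1); last first.
    by near: k; exact: (near_infty_natSinv_lt (PosNum e0)).
  set t := x 0 j; have k0 : 0 < k.+1%:R :> R by [].
  have -> : t - (Num.floor (k.+1%:R * t))%:~R / k.+1%:R =
      (k.+1%:R * t - (Num.floor (k.+1%:R * t))%:~R) / k.+1%:R.
    by rewrite mulrBl mulrAC divff ?mul1r// gt_eqF.
  rewrite normrM (ger0_norm (_ : 0 <= k.+1%:R^-1))// ler_piMl//.
  have /andP[f1 f2] := floor_itv (k.+1%:R * t).
  by rewrite ger0_norm ?subr_ge0// lerBlDr -[1]/(1%:~R) -rmorphD/= addrC ltW.
(* [z k] takes its values in a countable set and its fibres are boxes, so the preimage is a
   countable union of measurable boxes. *)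
move=> k _ Y mY; rewrite setTI.
rewrite (_ : _ @^-1` Y = \bigcup_(w in [set w | Y (f (h k w))])
    [set x : 'rV[R]_n | forall j, (Num.floor (k.+1%:R * x 0 j) == w 0 j)]);
    last first.
  apply/seteqP; split=> x /=.
    by move=> Yx; exists (z k x) => //= j; rewrite mxE.
  move=> [w /= Yw xw]; rewrite (_ : z k x = w)//.
  by apply/rowP => j; rewrite mxE; exact/eqP.
rewrite bigcup_mkcond; apply: countable_bigcupT_measurable => [|w].
  exact: countableP.
case: ifPn => _ //.
apply: (@measurable_box R n
  (fun j => [set t : R | Num.floor (k.+1%:R * t) == w 0 j])).
move=> j.
rewrite (_ : mkset _ =
    (fun t => k.+1%:R * t) @^-1` `[(w 0 j)%:~R, (w 0 j + 1)%:~R[).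
  rewrite -[X in measurable X]setTI; apply: measurable_funM => //.
apply/seteqP; split=> t; rewrite /= in_itv/=.
  by rewrite floor_eq.
by rewrite floor_eq.
Unshelve. all: by end_near. Qed.

End continuous_measurable_rV.

(** * An integrable weight *)

Section weight.
Context {R : realType}.
Local Notation lam := (@lebesgue_measure R).

(* An integrable product majorant of rapidly decreasing functions, comparable
   to its own translates by bounded vectors. *)
Definition weight n (x : 'rV[R]_n) : R := \prod_(i < n) (1 + x 0 i ^+ 2)^-1.

Let factor_gt0 (t : R) : 0 < 1 + t ^+ 2.
Proof. by rewrite ltr_wpDr// sqr_ge0. Qed.

Lemma weight_gt0 n (x : 'rV[R]_n) : 0 < weight x.
Proof. by apply: prodr_gt0 => i _; rewrite invr_gt0. Qed.

Lemma weight_le1 n (x : 'rV[R]_n) : weight x <= 1.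
Proof.
apply: prodr_ile1 => i _; rewrite invr_ge0 (ltW (factor_gt0 _))/=.
by rewrite invf_le1// lerDl sqr_ge0.
Qed.

Lemma weightV n (x : 'rV[R]_n) : (weight x)^-1 = \prod_(i < n) (1 + x 0 i ^+ 2).
Proof. by rewrite -prodfV; apply: eq_bigr => i _; rewrite invrK. Qed.

Lemma measurable_weight n : measurable_fun setT (@weight n).
Proof.
apply: measurable_prod => i _.
apply: (measurableT_comp (continuous_measurable_fun (@continuous_oneDsqrV R))).
exact: (measurable_rV_coord i).
Qed.

Lemma weight_cons n (a : R) (v : 'rV[R]_n) :
  weight (rV_cons (a, v)) = (1 + a ^+ 2)^-1 * weight v.
Proof.
rewrite /weight big_ord_recl rV_cons0; congr (_ * _).
by apply: eq_bigr => i _; rewrite rV_consS.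
Qed.

Lemma weight_step n (i : 'I_n) (t : R) (x : 'rV[R]_n) : `|t| <= 1 ->
  weight (x + t *: delta_mx 0 i) <= 3 * weight x.
Proof.
move=> t1; rewrite /weight (bigD1 i)//= [in leRHS](bigD1 i)//= mulrA.
rewrite !mxE !eqxx mulr1 (eq_bigr (fun j => (1 + x 0 j ^+ 2)^-1)); last first.
  by move=> j ji; rewrite !mxE (negPf ji) andbF mulr0 addr0.
apply: ler_wpM2r.
  by apply: prodr_ge0 => j _; rewrite invr_ge0 ltW.
rewrite ler_pdivlMr// mulrC ler_pdivrMr//; set a := x 0 i.
have t2 : t ^+ 2 <= 1.
  by rewrite -[t ^+ 2]real_normK ?num_real// expr_le1.
(* 3 (1 + (a + t)^2) - (1 + a^2) = (a + 2 t)^2 + (a + t)^2 + 2 (1 - t^2). *)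
have := sqr_ge0 (a + 2 * t); nra.
Qed.

Lemma integral_oneDsqrV_lty : (\int[lam]_x ((1 + x ^+ 2)^-1)%:E < +oo)%E.
Proof.
have mf : measurable_fun setT (fun x : R => ((1 + x ^+ 2)^-1)%:E).
  apply/measurable_EFinP; apply: continuous_measurable_fun.
  exact: continuous_oneDsqrV.
have f0 (x : R) : (0 <= ((1 + x ^+ 2)^-1)%:E)%E by rewrite lee_fin invr_ge0 ltW.
have I1 : (\int[lam]_(x in `[0%R, +oo[) ((1 + x ^+ 2)^-1)%:E = (pi / 2)%:E)%E.
  exact: integral0y_oneDsqr.
have I2 : (\int[lam]_(x in `]-oo, 0%R]) ((1 + x ^+ 2)^-1)%:E = (pi / 2)%:E)%E.
  rewrite -I1 ge0_integration_by_substitution0//.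
  by apply: eq_integral => x _; rewrite sqrrN.
rewrite (_ : [set: _] = `]-oo, 0%R] `|` `]0%R, +oo[); last first.
  by rewrite -setCitvl setUv.
rewrite ge0_integral_setU//=; last 2 first.
- by rewrite -setCitvl setUv.
- apply/disj_set2P/seteqP; split => x //= []; rewrite !in_itv/= andbT => x0.
  by rewrite ltNge x0.
rewrite I2; apply: lte_add_pinfty; first exact: ltry.
apply: le_lt_trans (ltry (pi / 2)); rewrite -I1.
apply: ge0_subset_integral => //.
- exact: measurable_funTS.
- by move=> x /=; rewrite !in_itv/= !andbT; exact: ltW.
Qed.

Lemma integral_weight_lty n : (\int[lebesgue_rV n]_x (weight x)%:E < +oo)%E.
Proof.
elim: n => [|n IHn].
  rewrite integral_dirac//= ?diracT ?mul1e ?ltry//.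
  by apply/measurable_EFinP; exact: measurable_weight.
have mw k : measurable_fun setT (fun v : 'rV[R]_k => (weight v)%:E).
  by apply/measurable_EFinP; exact: measurable_weight.
have w0 k (v : 'rV[R]_k) : (0 <= (weight v)%:E)%E by rewrite lee_fin ltW ?weight_gt0.
rewrite ge0_integral_rV_cons//.
set I := (\int[_]_v (weight v)%:E)%E in IHn.
have I0 : (0 <= I)%E by exact: integral_ge0.
rewrite (eq_integral (fun a : measurableTypeR R => ((1 + a ^+ 2)^-1)%:E * I)%E).
  rewrite ge0_integralZr//; last 2 first.
  - apply/measurable_EFinP; apply: continuous_measurable_fun.
    exact: continuous_oneDsqrV.
  - by move=> a _; rewrite lee_fin invr_ge0 ltW.
  apply: lte_mul_pinfty => //.
  - by apply: integral_ge0 => a _; rewrite lee_fin invr_ge0 ltW.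
  - rewrite ge0_fin_numE ?integral_oneDsqrV_lty//.
    by apply: integral_ge0 => a _; rewrite lee_fin invr_ge0 ltW.
move=> a _; under eq_integral do rewrite weight_cons EFinM.
rewrite ge0_integralZl//; last 2 first.
  exact: mw.
by rewrite lee_fin invr_ge0 ltW.
Qed.

End weight.

(** * Weighted bounds on first and second differences *)

Section differences.
Context {R : realType} (n : nat).
Implicit Types (v : 'rV[R]_n -> R) (x y : 'rV[R]_n).

Lemma is_derive_line v x (i : 'I_n) (t : R) :
  derivable v (x + t *: delta_mx 0 i) (delta_mx 0 i) ->
  is_derive t 1 (fun t => v (x + t *: delta_mx 0 i))
    ('D_(delta_mx 0 i) v (x + t *: delta_mx 0 i)).
Proof.
set e := delta_mx 0 i => dv.
have E : (fun h => h^-1 *: (((fun t => v (x + t *: e)) \o shift t) (h *: 1) -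
      v (x + t *: e))) =
    (fun h => h^-1 *: ((v \o shift (x + t *: e)) (h *: e) - v (x + t *: e))).
  apply/funext => h /=; congr (_ *: (v _ - _)).
  by rewrite scalerDl addrCA [h *: 1]mulr1.
by split; rewrite /derivable /derive /= E.
Qed.

(** Mean value theorem on the segment. The factor 3 is the cost of replacing the weight at the
    intermediate point by the weight at [x], which is where [|h| <= 1] enters. *)
Lemma partial_increment v (C : R) x (i : 'I_n) (h : R) : 0 <= C -> `|h| <= 1 ->
  (forall x, derivable v x (delta_mx 0 i)) ->
  (forall x, `|'D_(delta_mx 0 i) v x| <= C * weight x) ->
  `|v (x + h *: delta_mx 0 i) - v x| <= `|h| * (C * (3 * weight x)).
Proof.
move=> C0 h1 dv bv; set e := delta_mx 0 i.
pose g (t : R) : R := v (x + t *: e); pose dg (t : R) : R := 'D_e v (x + t *: e).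
have dgP (t : R) : is_derive t 1 g (dg t) by exact: is_derive_line.
have cg : continuous g.
  by move=> t; apply/differentiable_continuous/derivable1_diffP.
have bnd c : `|c| <= 1 -> `|dg c| <= C * (3 * weight x).
  by move=> c1; apply: le_trans (bv _) _; rewrite ler_wpM2l// weight_step.
have -> : v x = g 0 by rewrite /g scale0r addr0.
rewrite -/(g h) mulrC; have [h0|h0] := ger0P h.
  have [c ch ->] : exists2 c, c \in `[0, h] & g h - g 0 = dg c * (h - 0).
    by apply: MVT_segment => //; exact: continuous_subspaceT.
  rewrite subr0 normrM (ger0_norm h0) ler_wpM2r// bnd//.
  move: ch; rewrite in_itv/= => /andP[c0 ch].
  by rewrite ger0_norm// (le_trans ch)// -(ger0_norm h0).
have [c ch E] : exists2 c, c \in `[h, 0] & g 0 - g h = dg c * (0 - h).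
  by apply: MVT_segment => //; [exact: ltW|exact: continuous_subspaceT].
rewrite distrC E sub0r normrM normrN (ltr0_norm h0).
apply: ler_wpM2r; first by rewrite oppr_ge0 ltW.
apply: bnd; move: ch; rewrite in_itv/= => /andP[ch c0].
by rewrite ler0_norm// (le_trans _ h1)// (ltr0_norm h0) lerN2.
Qed.

(** The path from x to x + y follows the axes one after another, and each leg costs another factor 3
    in the weight. Two bounds on [y] are kept apart: 1 allows the comparison of weights, [r]
    measures the increment. *)
Lemma increment_bound v (C r : R) x y : 0 <= C -> 0 <= r ->
  (forall i x, derivable v x (delta_mx 0 i)) ->
  (forall i x, `|'D_(delta_mx 0 i) v x| <= C * weight x) ->
  (forall i, `|y 0 i| <= 1) -> (forall i, `|y 0 i| <= r) ->
  `|v (x + y) - v x| <= (n * 3 ^ n)%:R * C * r * weight x.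
Proof.
move=> C0 r0 dv bv y1 yr.
suff H s x' : `|v (x' + \sum_(i <- s) y 0 i *: delta_mx 0 i) - v x'| <=
    (size s * 3 ^ size s)%:R * C * r * weight x'.
  have := H (enum 'I_n) x; rewrite size_enum_ord big_enum/=.
  by rewrite -row_sum_delta.
elim: s x' => [|i s IHs] x'.
  by rewrite big_nil addr0 subrr normr0 mul0n mulr0n !mul0r.
rewrite big_cons addrA -(subrKA (v (x' + y 0 i *: delta_mx 0 i))).
apply: le_trans (ler_normD _ _) _.
have W0 := ltW (weight_gt0 x').
have h1 := partial_increment x' C0 (y1 i) (dv i) (bv i).
have h2 := IHs (x' + y 0 i *: delta_mx 0 i).
have h3 := weight_step i x' (y1 i).
set w := weight x' in W0 h1 h3 *; set w' := weight _ in h2 h3.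
set k : R := (size s * 3 ^ size s)%:R in h2 *.
have k0 : 0 <= k by exact: ler0n.
apply: (@le_trans _ _ (k * C * r * (3 * w) + r * (C * (3 * w)))).
  apply: lerD.
    by apply: le_trans h2 _; rewrite ler_wpM2l// !mulr_ge0.
  by apply: le_trans h1 _; rewrite ler_wpM2r// !mulr_ge0.
(* One more leg turns the constant k into 3 k + 3, which this expression exceeds or equals. *)
have -> : (size (i :: s) * 3 ^ size (i :: s))%:R = 3 * k + (3 ^ (size s).+1)%:R :> R.
  by rewrite /k -natrM -natrD; congr (_%:R); rewrite /= expnS; ring.
rewrite -subr_ge0; have : (3 : R) <= (3 ^ (size s).+1)%:R.
  by rewrite ler_nat -[3%N]expn1 leq_exp2l.
set z : R := (3 ^ _)%:R => z3.
have -> : (3 * k + z) * C * r * w - (k * C * r * (3 * w) + r * (C * (3 * w))) =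
  (z - 3) * (C * r * w) by ring.
by rewrite !mulr_ge0// subr_ge0.
Qed.

(* With w(z) = v(z + y) - v(z), the second difference of v at x is
   - (w(x) - w(x - y)): increment_bound is applied to v's partials, then to w. *)
Lemma second_increment_bound v (C r : R) x y : 0 <= C -> 0 <= r ->
  (forall i x, derivable v x (delta_mx 0 i)) ->
  (forall i j x, derivable ('D_(delta_mx 0 i) v) x (delta_mx 0 j)) ->
  (forall i j x, `|'D_(delta_mx 0 j) ('D_(delta_mx 0 i) v) x| <= C * weight x) ->
  (forall i, `|y 0 i| <= 1) -> (forall i, `|y 0 i| <= r) ->
  `|2 * v x - v (x + y) - v (x - y)| <=
    (n * 3 ^ n)%:R ^+ 2 * C * r ^+ 2 * weight (x - y).
Proof.
move=> C0 r0 dv ddv bv y1 yr; set k : R := (n * 3 ^ n)%:R.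
have k0 : 0 <= k by exact: ler0n.
pose w x := v (x + y) - v x.
have shiftP i x' : is_derive x' (delta_mx 0 i) (fun x => v (x + y))
    ('D_(delta_mx 0 i) v (x' + y)).
  set e := delta_mx 0 i.
  have E : (fun h : R => h^-1 *: (((fun x => v (x + y)) \o shift x') (h *: e) -
        v (x' + y))) =
      (fun h => h^-1 *: ((v \o shift (x' + y)) (h *: e) - v (x' + y))).
    by apply/funext => h /=; rewrite addrA.
  by split; rewrite /derivable /derive /= E//; exact: dv.
have wP i x' : is_derive x' (delta_mx 0 i) w
    ('D_(delta_mx 0 i) v (x' + y) - 'D_(delta_mx 0 i) v x').
  by apply: is_deriveB; exact: derivableP.
have -> : 2 * v x - v (x + y) - v (x - y) = - (w (x - y + y) - w (x - y)).
  by rewrite /w subrK; ring.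
rewrite normrN; have -> : k ^+ 2 * C * r ^+ 2 * weight (x - y) =
  k * (k * C * r) * r * weight (x - y) by ring.
have := @increment_bound w (k * C * r) r (x - y) y; rewrite -/k; apply => //.
  by rewrite !mulr_ge0.
move=> i x'; rewrite derive_val.
by have := @increment_bound ('D_(delta_mx 0 i) v) C r x' y; rewrite -/k; apply.
Qed.

(** Lies between min(1, |y|^2) and n times it; its integral against the kernel splits into the
    integrals for single coordinates. *)
Definition min_sqr_sum (y : 'rV[R]_n) : R := \sum_(i < n) Num.min 1 (y 0 i ^+ 2).

(** If all |y_i| <= 1, then [min_sqr_sum y] is |y|^2 and the second-order bound applies with r =
    |y|. Otherwise [min_sqr_sum y] is at least 1 and the triangle inequality suffices; the 2 in the
    constant is the coefficient of v(x). *)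
Lemma second_difference_bound v (C : R) x y : 0 <= C ->
  (forall x, `|v x| <= C * weight x) ->
  (forall i x, derivable v x (delta_mx 0 i)) ->
  (forall i j x, derivable ('D_(delta_mx 0 i) v) x (delta_mx 0 j)) ->
  (forall i j x, `|'D_(delta_mx 0 j) ('D_(delta_mx 0 i) v) x| <= C * weight x) ->
  `|2 * v x - v (x + y) - v (x - y)| <= ((n * 3 ^ n)%:R ^+ 2 + 2) * C *
    (min_sqr_sum y * (weight x + weight (x + y) + weight (x - y))).
Proof.
move=> C0 bv dv ddv bddv; set k : R := (n * 3 ^ n)%:R ^+ 2.
have k0 : 0 <= k by rewrite exprn_ge0.
have Wp (z : 'rV[R]_n) : 0 <= weight z by rewrite ltW// weight_gt0.
have min0 (t : R) : 0 <= Num.min 1 (t ^+ 2) by rewrite le_min ler01 sqr_ge0.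
have q0 : 0 <= min_sqr_sum y by exact: sumr_ge0.
have [y1|] := pselect (forall i, `|y 0 i| <= 1).
  have qE : min_sqr_sum y = enorm y ^+ 2.
    rewrite /enorm sqr_sqrtr ?dotRxx_ge0//; apply: eq_bigr => i _.
    rewrite -expr2 min_r// -[_ ^+ 2]real_normK ?num_real// expr_le1//.
  have yr i : `|y 0 i| <= enorm y.
    rewrite -sqrtr_sqr ler_wsqrtr// /dotR (bigD1 i)//= -expr2 lerDl.
    by apply: sumr_ge0 => j _; rewrite -expr2 sqr_ge0.
  apply: le_trans (second_increment_bound x C0 (enorm_ge0 y) dv ddv bddv y1 yr) _.
  rewrite -/k -qE -[leLHS]mulrA; apply: ler_pM => //.
  - exact: mulr_ge0.
  - exact: mulr_ge0.
  - by rewrite ler_wpM2r// lerDl.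
  - by rewrite ler_wpM2l// lerDr addr_ge0.
move=> /existsNP[i /negP]; rewrite -ltNge => yi.
have q1 : 1 <= min_sqr_sum y.
  rewrite /min_sqr_sum (bigD1 i)//= min_l; last first.
    by rewrite -[_ ^+ 2]real_normK ?num_real// exprn_ege1// ltW.
  by rewrite lerDl sumr_ge0.
set S := weight x + _ + _.
have S0 : 0 <= S by rewrite !addr_ge0.
apply: (@le_trans _ _ (2 * C * S)).
  apply: le_trans (ler_normB _ _) _.
  apply: le_trans (lerD (ler_normB _ _) (lexx _)) _.
  rewrite normrM ger0_norm//.
  have := bv x; have := bv (x + y); have := bv (x - y).
  have := mulr_ge0 C0 (Wp (x + y)); have := mulr_ge0 C0 (Wp (x - y)).
  rewrite /S; lra.
apply: ler_pM => //; first by rewrite mulr_ge0.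
  by rewrite ler_wpM2r// lerDr.
by rewrite ler_peMl.
Qed.

End differences.

(** * Fubini for a real multiplier *)

Lemma integrable_dominated d (T : measurableType d) (R : realType)
    (mu : {measure set T -> \bar R}) (f g : T -> R) :
  measurable_fun setT f -> measurable_fun setT g ->
  (forall x, `|f x| <= g x) -> (\int[mu]_x (g x)%:E < +oo)%E ->
  mu.-integrable setT (EFin \o f).
Proof.
move=> mf mg fg goo.
have g0 x : 0 <= g x by exact: le_trans (normr_ge0 _) (fg x).
apply: (@le_integrable _ _ _ mu _ measurableT _ (EFin \o g)).
- exact/measurable_EFinP.
- by move=> x _; rewrite lee_fin (ger0_norm (g0 x)).
- apply/integrableP; split; first exact/measurable_EFinP.
  by under eq_integral do rewrite gee0_abs ?lee_fin//.
Qed.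

Section fubini_multiplier.
Context {R : realType} (n : nat) (s gamma : R).
Local Notation mu := (@lebesgue_rV R n.+1).
Local Notation p := (n.+1%:R + 2 * s).
Hypotheses (s_gt0 : 0 < s) (gamma_gt0 : 0 < gamma).
Hypothesis gammaE : (gamma%:E * \int[mu]_z
  ((1 - cos (z 0 ord_max)) / enorm z `^ p)%:E = 1)%E.

Lemma integral_translate (y : 'rV[R]_n.+1) (f : 'rV[R]_n.+1 -> \bar R) :
  measurable_fun setT f ->
  (\int[mu]_x f (x + y)%R = \int[mu]_x f x)%E.
Proof.
move=> mf; rewrite [LHS]integralE [RHS]integralE.
congr (_ - _)%E.
  rewrite -(ge0_integral_translate y (measurable_funepos mf) (funepos_ge0 f)).
  by apply: eq_integral => x _; rewrite (funepos_comp f).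
rewrite -(ge0_integral_translate y (measurable_funeneg mf) (funeneg_ge0 f)).
by apply: eq_integral => x _; rewrite (funeneg_comp f).
Qed.

Lemma Rintegral_translate (y : 'rV[R]_n.+1) (f : 'rV[R]_n.+1 -> R) :
  measurable_fun setT f ->
  \int[mu]_x f (x + y) = \int[mu]_x f x.
Proof.
move=> mf; rewrite /Rintegral; congr fine.
by apply: (@integral_translate y (EFin \o f)); exact/measurable_EFinP.
Qed.

Lemma integrable_translate (y : 'rV[R]_n.+1) (f : 'rV[R]_n.+1 -> \bar R) :
  mu.-integrable setT f -> mu.-integrable setT (fun x => f (x + y)).
Proof.
move=> /integrableP[mf foo]; apply/integrableP; split.
  by apply: (measurableT_comp mf); exact: measurable_rVD.
by rewrite (@integral_translate y (abse \o f))//; exact: measurableT_comp.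
Qed.

Local Notation qk := (fun y : 'rV[R]_n.+1 => min_sqr_sum y / enorm y `^ p).

Lemma min_sqr_sum_ge0 (y : 'rV[R]_n.+1) : 0 <= min_sqr_sum y.
Proof. by apply: sumr_ge0 => i _; rewrite le_min ler01 sqr_ge0. Qed.

Lemma measurable_min_sqr_kernel : measurable_fun setT qk.
Proof.
apply: measurable_funM; last exact: measurable_enorm_powRV.
apply: measurable_sum => i; apply: measurable_minr => //.
by apply: measurable_funX; exact: (measurable_rV_coord i).
Qed.

Lemma integral_min_sqr_kernel_lty : (\int[mu]_y (qk y)%:E < +oo)%E.
Proof.
under eq_integral do rewrite mulr_suml -sumEFin.
rewrite ge0_integral_sum//.
- apply: lte_sum_pinfty => i _.
  exact: (integral_min_kernel_lty s_gt0 gamma_gt0 gammaE).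
- move=> i; apply/measurable_EFinP.
  apply: measurable_funM; last exact: measurable_enorm_powRV.
  apply: measurable_minr => //.
  by apply: measurable_funX; exact: (measurable_rV_coord i).
- move=> i y _; rewrite lee_fin divr_ge0 ?powR_ge0//.
  by rewrite le_min ler01 sqr_ge0.
Qed.

(** [v] stands for the real or imaginary part of u, [e] for the cosine or sine of the phase, and
    [xi] for 2 pi times the frequency. *)
Variables (v e : 'rV[R]_n.+1 -> R) (C : R) (xi : 'rV[R]_n.+1).
Hypotheses (mv : measurable_fun setT v) (me : measurable_fun setT e).
Hypothesis e1 : forall x, `|e x| <= 1.
(* Satisfied by the real and imaginary parts of e^{-i <xi, x>}. *)
Hypothesis eD : forall x y, e (x + y) + e (x - y) = 2 * cos (dotR xi y) * e x.
Hypothesis C0 : 0 <= C.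
Hypothesis v_weight : forall x, `|v x| <= C * weight x.
Hypothesis v_diff : forall x y, `|2 * v x - v (x + y) - v (x - y)| <=
  C * (min_sqr_sum y * (weight x + weight (x + y) + weight (x - y))).

Let K (x y : 'rV[R]_n.+1) : R :=
  (2 * v x - v (x + y) - v (x - y)) / enorm y `^ p.

Let mK : measurable_fun setT (fun z : 'rV[R]_n.+1 * 'rV[R]_n.+1 => K z.1 z.2).
Proof.
have m1 := @measurable_fst _ _ 'rV[R]_n.+1 'rV[R]_n.+1.
have m2 := @measurable_snd _ _ 'rV[R]_n.+1 'rV[R]_n.+1.
apply: measurable_funM; last first.
  exact: (measurableT_comp (@measurable_enorm_powRV R n s)).
apply: measurable_funB; first apply: measurable_funB.
- by apply: measurable_funM => //; exact: (measurableT_comp mv).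
- by apply: (measurableT_comp mv); exact: measurable_rVD.
- by apply: (measurableT_comp mv); exact: measurable_rVB.
Qed.

Let mKx x : measurable_fun setT (K x).
Proof. exact: (measurableT_comp mK (pair1_measurable x)). Qed.

Let mKy y : measurable_fun setT (K ^~ y).
Proof. exact: (measurableT_comp mK (pair2_measurable y)). Qed.

Let K_bound x y :
  `|K x y| <= C * qk y * (weight x + weight (x + y) + weight (x - y)).
Proof.
rewrite normrM (ger0_norm (enorm_powRV_ge0 s y)).
apply: le_trans (ler_wpM2r (enorm_powRV_ge0 s y) (v_diff x y)) _.
by rewrite le_eqVlt; apply/orP; left; apply/eqP; ring.
Qed.

Let qk0 y : 0 <= qk y.
Proof. by rewrite mulr_ge0 ?min_sqr_sum_ge0 ?enorm_powRV_ge0. Qed.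

Let mqk (c : R) : measurable_fun setT (fun y => c * qk y).
Proof. by apply: measurable_funM => //; exact: measurable_min_sqr_kernel. Qed.

(** Each of the three weights is at most 1, whence the factor 3. This is what lets the constant e(x)
    pass under the integral in y. *)
Let Kx_integrable x : mu.-integrable setT (EFin \o K x).
Proof.
apply: (integrable_dominated (mKx x) (mqk (3 * C))) => [y|].
  apply: le_trans (K_bound x y) _.
  have := weight_le1 x; have := weight_le1 (x + y); have := weight_le1 (x - y).
  have := mulr_ge0 C0 (qk0 y); set a := C * _ => a0 h1 h2 h3.
  rewrite -mulrA [leRHS]mulrC; apply: ler_wpM2l => //; lra.
under eq_integral do rewrite EFinM.
rewrite ge0_integralZl//.
- apply: lte_mul_pinfty => //; first by rewrite lee_fin mulr_ge0.
  exact: integral_min_sqr_kernel_lty.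
- by apply/measurable_EFinP; exact: measurable_min_sqr_kernel.
- by move=> y _; rewrite lee_fin; exact: qk0.
- by rewrite lee_fin mulr_ge0.
Qed.

Let weight_integrable (c : R) :
  (\int[mu]_x (c * weight x)%:E = c%:E * \int[mu]_x (weight x)%:E)%E.
Proof.
under eq_integral do rewrite EFinM.
rewrite integralZl//; apply: (integrable_dominated _ _ _ (integral_weight_lty _)).
- exact: measurable_weight.
- exact: measurable_weight.
- by move=> x; rewrite ger0_norm// ltW// weight_gt0.
Qed.

Lemma integrable_mul_bounded (f : 'rV[R]_n.+1 -> R) : measurable_fun setT f ->
  (forall x, `|f x| <= 1) -> mu.-integrable setT (EFin \o (fun x => f x * v x)).
Proof.
move=> mf f1; apply: (@integrable_dominated _ _ _ mu _ (fun x => C * weight x)).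
- exact: measurable_funM.
- by apply: measurable_funM => //; exact: measurable_weight.
- move=> x; rewrite normrM; apply: le_trans (v_weight x).
  by rewrite ler_piMl.
- rewrite weight_integrable; apply: lte_mul_pinfty => //.
  exact: integral_weight_lty.
Qed.

Let meK : measurable_fun setT
  (fun z : 'rV[R]_n.+1 * 'rV[R]_n.+1 => (e z.1 * K z.1 z.2)%:E).
Proof.
apply/measurable_EFinP; apply: measurable_funM => //.
exact: (measurableT_comp me).
Qed.

Let B := fine (\int[mu]_x (weight x)%:E).

Let BE : (\int[mu]_x (weight x)%:E = B%:E)%E.
Proof.
rewrite fineK// ge0_fin_numE ?integral_weight_lty//.
by apply: integral_ge0 => x _; rewrite lee_fin ltW// weight_gt0.
Qed.

Let integral_weight3 y : (\int[mu]_x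
  (weight x + weight (x + y) + weight (x - y))%:E = (3 * B)%:E)%E.
Proof.
have mw : measurable_fun setT (fun x : 'rV[R]_n.+1 => (weight x)%:E).
  by apply/measurable_EFinP; exact: measurable_weight.
have w0 (x : 'rV[R]_n.+1) : (0 <= (weight x)%:E)%E.
  by rewrite lee_fin ltW// weight_gt0.
have mwy z : measurable_fun setT (fun x : 'rV[R]_n.+1 => (weight (x + z))%:E).
  by apply: (measurableT_comp mw); exact: measurable_rVD.
under eq_integral do rewrite 2!EFinD.
rewrite ge0_integralD; [|exact: measurableT|by move=> x _; rewrite adde_ge0|
  exact: emeasurable_funD|by []|exact: mwy].
rewrite ge0_integralD; [|exact: measurableT|by []|exact: mw|by []|exact: mwy].
rewrite (ge0_integral_translate y mw w0) (ge0_integral_translate (- y) mw w0).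
by rewrite BE -!EFinD; congr (_%:E); ring.
Qed.

Let mweight3 y : measurable_fun setT
  (fun x : 'rV[R]_n.+1 => weight x + weight (x + y) + weight (x - y)).
Proof.
have mw := @measurable_weight R n.+1.
apply: measurable_funD; first apply: measurable_funD => //.
  by apply: (measurableT_comp mw); exact: measurable_rVD.
by apply: (measurableT_comp mw); exact: measurable_rVB.
Qed.

Let integral_bound y : (\int[mu]_x
  (C * qk y * (weight x + weight (x + y) + weight (x - y)))%:E =
  (3 * B * C * qk y)%:E)%E.
Proof.
under eq_integral do rewrite EFinM.
rewrite ge0_integralZl; last 4 first.
- exact: measurableT.
- by apply/measurable_EFinP; exact: mweight3.
- by move=> x _; rewrite lee_fin !addr_ge0// ltW// weight_gt0.
- by rewrite lee_fin mulr_ge0.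
by rewrite integral_weight3 -EFinM; congr (_%:E); ring.
Qed.

Let eK_bound x y : `|e x * K x y| <=
  C * qk y * (weight x + weight (x + y) + weight (x - y)).
Proof. by rewrite normrM; apply: le_trans (K_bound x y); rewrite ler_piMl. Qed.

Let eKy_integrable y : mu.-integrable setT (EFin \o (fun x => e x * K x y)).
Proof.
apply: (integrable_dominated _ _ (eK_bound ^~ y)).
- exact: measurable_funM.
- by apply: measurable_funM => //; exact: mweight3.
- by rewrite integral_bound ltry.
Qed.

(** Integrating in x first, translation invariance makes the three weights contribute [3 * B]
    whatever y is, and the integrable factor [qk y] remains. *)
Let eK_integrable : (mu \x mu)%E.-integrable setT
  (fun z : 'rV[R]_n.+1 * 'rV[R]_n.+1 => (e z.1 * K z.1 z.2)%:E).
Proof.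
apply/integrable21ltyP; first exact: meK.
have B0 : 0 <= B.
  by apply: fine_ge0; apply: integral_ge0 => x _; rewrite lee_fin ltW// weight_gt0.
apply: (@le_lt_trans _ _ (\int[mu]_y (3 * B * C * qk y)%:E)%E); last first.
  under eq_integral do rewrite EFinM.
  rewrite ge0_integralZl; last 4 first.
  - exact: measurableT.
  - by apply/measurable_EFinP; exact: measurable_min_sqr_kernel.
  - by move=> y _; rewrite lee_fin; exact: qk0.
  - by rewrite lee_fin !mulr_ge0.
  apply: lte_mul_pinfty => //; first by rewrite lee_fin !mulr_ge0.
  exact: integral_min_sqr_kernel_lty.
apply: ge0_le_integral => //.
- by move=> y _; exact: integral_ge0.
- apply: (measurable_fun_fubini_tonelli_G
    (abse \o (fun z : 'rV[R]_n.+1 * 'rV[R]_n.+1 => (e z.1 * K z.1 z.2)%:E))) => //=.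
  exact: measurableT_comp.
- by apply/measurable_EFinP; exact: mqk.
move=> y _; rewrite -integral_bound; apply: ge0_le_integral => //.
- apply: measurableT_comp => //.
  exact: (measurableT_comp meK (pair2_measurable y)).
- apply/measurable_EFinP; apply: measurable_funM => //; exact: mweight3.
- by move=> x _; rewrite lee_fin; exact: eK_bound.
Qed.

Let E := \int[mu]_x (e x * v x).

(** Translation moves the shifts from [v] to [e], where [eD] turns e(x + y) + e(x - y) into a
    multiple of e(x). *)
Let inner_integral y : \int[mu]_x (e x * K x y) =
  2 * E * ((1 - cos (dotR xi y)) / enorm y `^ p).
Proof.
(* Chosen so that g y (x + y) = e(x) v(x + y) and g (- y) (x - y) = e(x) v(x - y). *)
pose g z x := e (x - z) * v x.
have ig z : mu.-integrable setT (EFin \o g z).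
  apply: (@integrable_mul_bounded (fun x => e (x - z))) => //.
  by apply: (measurableT_comp me); exact: measurable_rVB.
have igt z : mu.-integrable setT (EFin \o (fun x => g z (x + z))).
  exact: (integrable_translate z (ig z)).
have mg z : measurable_fun setT (g z).
  apply: measurable_funM => //.
  by apply: (measurableT_comp me); exact: measurable_rVB.
have iev : mu.-integrable setT (EFin \o (fun x => e x * v x)).
  exact: integrable_mul_bounded.
have iev2 : mu.-integrable setT (EFin \o (fun x => 2 * (e x * v x))).
  exact: (integrableZl measurableT 2 iev).
have -> : \int[mu]_x (e x * K x y) = \int[mu]_x ((enorm y `^ p)^-1 *
    (2 * (e x * v x) - g y (x + y) - g (- y) (x + - y))).
  by apply: eq_Rintegral => x _; rewrite /g /K !addrK; ring.
rewrite RintegralZl; [|exact: measurableT|]; last first.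
  exact: (integrableB measurableT (integrableB measurableT iev2 (igt y)) (igt (- y))).
rewrite RintegralB//; last exact: (integrableB measurableT iev2 (igt y)).
rewrite RintegralB// RintegralZl// -/E.
rewrite !Rintegral_translate//.
have -> : 2 * E - \int[mu]_x g y x - \int[mu]_x g (- y) x =
    2 * E - \int[mu]_x (g y x + g (- y) x).
  by rewrite RintegralD// opprD addrA.
have -> : \int[mu]_x (g y x + g (- y) x) = 2 * cos (dotR xi y) * E.
  rewrite -RintegralZl//; apply: eq_Rintegral => x _.
  by rewrite /g opprK -mulrDl mulrA [e _ + _]addrC eD.
ring.
Qed.

Let cos_kernel_integrable : mu.-integrable setT
  (EFin \o (fun y => (1 - cos (dotR xi y)) / enorm y `^ p)).
Proof.
have mc : measurable_fun setT
    (fun y : 'rV[R]_n.+1 => (1 - cos (dotR xi y)) / enorm y `^ p).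
  apply: measurable_funM; last exact: measurable_enorm_powRV.
  apply: measurable_funB => //.
  apply: (measurableT_comp (continuous_measurable_fun (@continuous_cos R))).
  exact: measurable_dotR.
apply: (integrable_dominated mc mc) => [y|].
  by rewrite ger0_norm// mulr_ge0 ?one_minus_cos_ge0 ?enorm_powRV_ge0.
by rewrite (integral_one_minus_cos_kernel s_gt0 gamma_gt0 gammaE) ltry.
Qed.

Let eKx_integrable x : mu.-integrable setT (EFin \o (fun y => e x * K x y)).
Proof. exact: (integrableZl measurableT (e x) (Kx_integrable x)). Qed.

(** Fubini is stated for extended-real integrals; integrability of the slices makes them finite, so
    that [fine] loses nothing. *)
Let FE x : (\int[mu]_y (e x * K x y))%:E = (\int[mu]_y (e x * K x y)%:E)%E.
Proof.
rewrite /Rintegral fineK//.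
exact: (integrable_fin_num measurableT (eKx_integrable x)).
Qed.

Let GE y : (\int[mu]_x (e x * K x y))%:E = (\int[mu]_x (e x * K x y)%:E)%E.
Proof.
rewrite /Rintegral fineK//.
exact: (integrable_fin_num measurableT (eKy_integrable y)).
Qed.

Let F_integrable : mu.-integrable setT
  (EFin \o (fun x => \int[mu]_y (e x * K x y))).
Proof.
rewrite (_ : EFin \o _ = fubini_F mu
    (fun z : 'rV[R]_n.+1 * 'rV[R]_n.+1 => (e z.1 * K z.1 z.2)%:E)).
  exact: integrable_fubini_F.
by apply/funext => x /=; rewrite FE.
Qed.

Let multE x : e x * (gamma / 2 * \int[mu]_y K x y) =
  gamma / 2 * \int[mu]_y (e x * K x y).
Proof. by rewrite RintegralZl//; ring. Qed.

Lemma integrable_frac_laplacian_mult : mu.-integrable setT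
  (EFin \o (fun x => e x * (gamma / 2 * \int[mu]_y K x y))).
Proof.
rewrite (_ : EFin \o _ = fun x =>
    ((gamma / 2)%:E * (EFin \o (fun x => \int[mu]_y (e x * K x y))%R) x)%E).
  exact: (integrableZl measurableT (gamma / 2) F_integrable).
by apply/funext => x /=; rewrite multE.
Qed.

Lemma Rintegral_frac_laplacian_mult :
  \int[mu]_x (e x * (gamma / 2 * \int[mu]_y K x y)) =
  enorm xi `^ (2 * s) * \int[mu]_x (e x * v x).
Proof.
transitivity (gamma / 2 * \int[mu]_x \int[mu]_y (e x * K x y)).
  by rewrite -RintegralZl//; apply: eq_Rintegral => x _; exact: multE.
have -> : \int[mu]_x \int[mu]_y (e x * K x y) =
    \int[mu]_y \int[mu]_x (e x * K x y).
  transitivity (fine (\int[mu]_x \int[mu]_y (e x * K x y)%:E)%E).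
    by apply: (congr1 fine); apply: eq_integral => x _; exact: FE.
  rewrite (Fubini eK_integrable).
  by apply: (congr1 fine); apply: eq_integral => y _; rewrite -GE.
under eq_Rintegral do rewrite inner_integral.
rewrite RintegralZl// -/E.
rewrite {1}/Rintegral (integral_one_minus_cos_kernel s_gt0 gamma_gt0 gammaE).
(* The factor gamma / 2 cancels the 2 of [inner_integral] and the 1 / gamma of the kernel
   integral. *)
by rewrite [fine _]/=; field; rewrite gt_eqF.
Qed.

End fubini_multiplier.

(** * From Schwartz seminorms to weighted bounds *)

Section schwartz_bounds.
Context {R : realType} (n : nat).
Implicit Types (u : 'rV[R]_n -> R[i]).

(** Each factor is at most 1 + |x|^2, and (1 + r)^n <= 2^n (1 + r^n) according to whether r <= 1 or
    r > 1. The decay estimates of exponents 0 and 2 n therefore yield a bound by [weight]. *)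
Lemma weightV_le (x : 'rV[R]_n) :
  (weight x)^-1 <= 2 ^+ n * (1 + enorm x ^+ (2 * n)).
Proof.
rewrite weightV; apply: (@le_trans _ _ ((1 + enorm x ^+ 2) ^+ n)).
  have -> : (1 + enorm x ^+ 2) ^+ n = \prod_(i < n) (1 + enorm x ^+ 2).
    by rewrite prodr_const card_ord.
  apply: ler_prod => i _.
  rewrite addr_ge0 ?sqr_ge0//= lerD2l /enorm sqr_sqrtr ?dotRxx_ge0//.
  rewrite /dotR (bigD1 i)//= -expr2 lerDl.
  by apply: sumr_ge0 => j _; rewrite -expr2 sqr_ge0.
rewrite exprM; set r := enorm x ^+ 2; have r0 : 0 <= r by exact: sqr_ge0.
have p0 m : 0 <= r ^+ m by rewrite exprn_ge0.
have [r1|r1] := leP r 1.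
  apply: (@le_trans _ _ (2 ^+ n)); last by rewrite ler_peMr ?exprn_ge0// lerDl.
  by rewrite lerXn2r ?nnegrE ?addr_ge0// -[2]/(1 + 1) lerD2l.
apply: (@le_trans _ _ ((2 * r) ^+ n)).
  have h : 1 + r <= 2 * r by rewrite mulr_natl mulr2n lerD2r ltW.
  by apply: lerXn2r => //; rewrite nnegrE; [exact: addr_ge0|exact: mulr_ge0].
by rewrite exprMn ler_wpM2l ?exprn_ge0// lerDr.
Qed.

Lemma schwartz_weight u (a : seq 'I_n) : schwartz u ->
  exists2 C, 0 <= C &
    forall x, Normc.normc (iter_partial a u x) <= C * weight x.
Proof.
move=> [_ Su]; have [M0 h0] := Su a 0; have [M1 h1] := Su a (2 * n)%N.
have nc0 x : 0 <= Normc.normc (iter_partial a u x).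
  by case: (iter_partial a u x) => p q; exact: sqrtr_ge0.
have M00 : 0 <= M0 by apply: le_trans (h0 0); rewrite expr0 mul1r.
have M10 : 0 <= M1.
  by apply: le_trans (h1 0); rewrite mulr_ge0 ?exprn_ge0 ?enorm_ge0.
exists (2 ^+ n * (M0 + M1)); first by rewrite mulr_ge0 ?exprn_ge0 ?addr_ge0.
move=> x; rewrite -ler_pdivrMr ?weight_gt0//.
apply: (le_trans (ler_wpM2l (nc0 x) (weightV_le x))).
rewrite mulrCA; apply: ler_wpM2l; first by rewrite exprn_ge0.
rewrite mulrDr mulr1; apply: lerD; last by rewrite mulrC; exact: h1.
by have := h0 x; rewrite expr0 mul1r.
Qed.

Lemma normc_Re (z : R[i]) : `|complex.Re z| <= Normc.normc z.
Proof. by case: z => p q /=; rewrite -sqrtr_sqr ler_wsqrtr// lerDl sqr_ge0. Qed.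

Lemma normc_Im (z : R[i]) : `|complex.Im z| <= Normc.normc z.
Proof. by case: z => p q /=; rewrite -sqrtr_sqr ler_wsqrtr// lerDr sqr_ge0. Qed.

(** Abstracting [f] treats the real and imaginary parts at once. *)
Lemma schwartz_component (f : R[i] -> R) u :
  (forall z, `|f z| <= Normc.normc z) ->
  (forall (w : 'rV[R]_n -> R[i]) i x,
    f (Cpartial i w x) = 'D_(delta_mx 0 i) (f \o w) x) ->
  (forall a, continuous (f \o iter_partial a u)) ->
  (forall a i x, derivable (f \o iter_partial a u) x (delta_mx 0 i)) ->
  schwartz u ->
  exists C, [/\ measurable_fun setT (f \o u), 0 <= C,
    forall x, `|f (u x)| <= C * weight x &
    forall x y, `|2 * f (u x) - f (u (x + y)) - f (u (x - y))| <=
      C * (min_sqr_sum y * (weight x + weight (x + y) + weight (x - y)))].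
Proof.
move=> f_norm fD cf df Su.
have Df i (w : 'rV[R]_n -> R[i]) : 'D_(delta_mx 0 i) (f \o w) = f \o Cpartial i w.
  by apply/funext => x /=; rewrite fD.
have [C0 C00 h0] := schwartz_weight [::] Su.
have /choice[C1 h1] (ij : 'I_n * 'I_n) : exists C, 0 <= C /\
    forall x, Normc.normc (iter_partial [:: ij.2; ij.1] u x) <= C * weight x.
  by have [C ? ?] := schwartz_weight [:: ij.2; ij.1] Su; exists C.
(* One constant for u and all its second partials: the sum dominates each of these nonnegative
   constants. *)
pose C := C0 + \sum_ij C1 ij.
have S0 : 0 <= \sum_ij C1 ij by apply: sumr_ge0 => ij _; exact: (h1 ij).1.
have C_ge0 : 0 <= C by rewrite addr_ge0.
have w0 (x : 'rV[R]_n) : 0 <= weight x by rewrite ltW// weight_gt0.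
have hv x : `|f (u x)| <= C * weight x.
  apply: le_trans (f_norm _) (le_trans (h0 x) _).
  by rewrite ler_wpM2r// lerDl.
set k : R := (n * 3 ^ n)%:R ^+ 2 + 2.
have k1 : 1 <= k by rewrite /k (le_trans (_ : 1 <= 2))// ?ler1n// lerDr sqr_ge0.
exists (k * C); split.
- exact: (continuous_measurable_rV (cf [::])).
- by rewrite mulr_ge0// (le_trans ler01).
- move=> x; apply: le_trans (hv x) _; rewrite -mulrA ler_peMl//.
  by rewrite mulr_ge0.
- move=> x y; apply: (@second_difference_bound _ _ (f \o u)) => //.
  + by move=> i z; exact: (df [::]).
  + by move=> i j z; rewrite Df; exact: (df [:: i]).
  + move=> i j z; rewrite Df -(fD (Cpartial i u)).
    apply: le_trans (f_norm _) (le_trans ((h1 (i, j)).2 z) _).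
    rewrite ler_wpM2r// /C (bigD1 (i, j))//= addrCA lerDl addr_ge0//.
    by apply: sumr_ge0 => ij _; exact: (h1 ij).1.
Qed.

End schwartz_bounds.

(** * Real and imaginary parts of the complex integrals *)

Local Open Scope complex_scope.

Lemma complexZl (R : realType) (c a b : R) :
  (c%:C * (a +i* b) : R[i]) = (c * a) +i* (c * b).
Proof. by apply/eqP; rewrite eq_complex /= !mul0r subr0 addr0 !eqxx. Qed.

Section fourier_components.
Context {R : realType} (n : nat).
Local Notation mu := (@lebesgue_rV R n).

Lemma Cintegral_second_difference (u : 'rV[R]_n -> R[i]) (k : 'rV[R]_n -> R) x :
  Cintegral (fun y => (2 * u x - u (x + y) - u (x - y)) / (k y)%:C) =
  (\int[mu]_y ((2 * complex.Re (u x) - complex.Re (u (x + y)) -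
     complex.Re (u (x - y))) / k y)) +i*
  (\int[mu]_y ((2 * complex.Im (u x) - complex.Im (u (x + y)) -
     complex.Im (u (x - y))) / k y)).
Proof.
rewrite /Cintegral; congr (_ +i* _); apply: eq_Rintegral => y _.
all: rewrite -fmorphV/= !mulr_natl !mulr2n.
all: case: (u x) (u (x + y)) (u (x - y)) => a b [c d] [e f] /=; ring.
Qed.

(** Integrability of the four products allows the integrals of cos * a - sin * b and cos * b + sin *
    a to be split. *)
Lemma fourierE (a b : 'rV[R]_n -> R) xi (theta : 'rV[R]_n -> R) :
  (forall x, theta x = - (2 * pi * dotR xi x)) ->
  mu.-integrable setT (EFin \o (fun x => cos (theta x) * a x)) ->
  mu.-integrable setT (EFin \o (fun x => sin (theta x) * a x)) ->
  mu.-integrable setT (EFin \o (fun x => cos (theta x) * b x)) ->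
  mu.-integrable setT (EFin \o (fun x => sin (theta x) * b x)) ->
  fourier (fun x => a x +i* b x) xi =
  (\int[mu]_x (cos (theta x) * a x) - \int[mu]_x (sin (theta x) * b x)) +i*
  (\int[mu]_x (cos (theta x) * b x) + \int[mu]_x (sin (theta x) * a x)).
Proof.
move=> thetaE ica isa icb isb; rewrite /fourier /Cintegral.
rewrite -RintegralB// -RintegralD//.
by congr (_ +i* _); apply: eq_Rintegral => x _; rewrite thetaE.
Qed.

End fourier_components.

Lemma frac_laplacianE (R : realType) (n : nat) (gamma s : R)
    (u : 'rV[R]_n -> R[i]) :
  let L (v : 'rV[R]_n -> R) x := gamma / 2 * \int[lebesgue_rV n]_y
    ((2 * v x - v (x + y) - v (x - y)) / enorm y `^ (n%:R + 2 * s)) in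
  frac_laplacian gamma s u =
  fun x => L (@complex.Re R \o u) x +i* L (@complex.Im R \o u) x.
Proof.
apply/funext => x; rewrite /frac_laplacian Cintegral_second_difference.
exact: complexZl.
Qed.

Theorem proposition5p1 (R : realType) (n : nat) (s gamma : R)
  (s_gt0 : 0 < s) (s_lt1 : s < 1) (gamma_gt0 : 0 < gamma)
  (gammaE : (gamma%:E * \int[lebesgue_rV n.+1]_z
      ((1 - cos (z 0 ord_max)) / enorm z `^ (n.+1%:R + 2 * s))%:E)%E = 1%E) :
  forall u : 'rV[R]_n.+1 -> R[i], schwartz u ->
  forall xi : 'rV[R]_n.+1,
    fourier (frac_laplacian gamma s u) xi =
    ((2 * pi * enorm xi) `^ (2 * s))%:C * fourier u xi.
Proof.
move=> u Su xi; have Sm := Su.1.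
have [Ca [ma Ca0 wa da]] := schwartz_component (@normc_Re R)
  (fun _ _ _ => erefl) (fun a => let: And3 h _ _ := Sm a in h)
  (fun a i x => let: And3 _ _ h := Sm a in (h i x).1) Su.
have [Cb [mb Cb0 wb db]] := schwartz_component (@normc_Im R)
  (fun _ _ _ => erefl) (fun a => let: And3 _ h _ := Sm a in h)
  (fun a i x => let: And3 _ _ h := Sm a in (h i x).2) Su.
pose theta x := - (2 * pi * dotR xi x).
(* Absorbs the 2 pi of the Fourier convention: the phase is - <xi', x>, and |xi'|^(2 s) is the
   multiplier sought. *)
pose xi' := (2 * pi) *: xi.
have pi0 : 0 <= 2 * pi :> R by rewrite mulr_ge0 ?pi_ge0.
have nxi : enorm xi' = 2 * pi * enorm xi by rewrite enormZ ger0_norm.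
have thetaD x y : theta (x + y) = theta x + theta y.
  by rewrite /theta dotRDr mulrDr opprD.
have thetaB x y : theta (x - y) = theta x - theta y.
  by rewrite /theta dotRDr dotRNr mulrBr opprB addrC opprK.
have cosxi y : cos (dotR xi' y) = cos (theta y).
  by rewrite /theta dotRZl cosN.
have mtheta : measurable_fun setT theta.
  apply: measurable_funN; apply: measurable_funM => //; exact: measurable_dotR.
have mcos : measurable_fun setT (fun x => cos (theta x)).
  exact: (measurableT_comp (continuous_measurable_fun (@continuous_cos R))).
have msin : measurable_fun setT (fun x => sin (theta x)).
  exact: (measurableT_comp (continuous_measurable_fun (@continuous_sin R))).
have cos1 x : `|cos (theta x)| <= 1 by exact: cos_max.
have sin1 x : `|sin (theta x)| <= 1 by exact: sin_max.
have cosDB x y : cos (theta (x + y)) + cos (theta (x - y)) =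
    2 * cos (dotR xi' y) * cos (theta x).
  by rewrite cosxi thetaD thetaB cosD cosB; ring.
have sinDB x y : sin (theta (x + y)) + sin (theta (x - y)) =
    2 * cos (dotR xi' y) * sin (theta x).
  by rewrite cosxi thetaD thetaB sinD sinB; ring.
have uE : u = fun x => (@complex.Re R \o u) x +i* (@complex.Im R \o u) x.
  by apply/funext => x /=; case: (u x).
rewrite frac_laplacianE [in RHS]uE.
rewrite (@fourierE _ _ (@complex.Re R \o u) (@complex.Im R \o u) xi theta)//; last 4 first.
- exact: (integrable_mul_bounded ma Ca0 wa mcos cos1).
- exact: (integrable_mul_bounded ma Ca0 wa msin sin1).
- exact: (integrable_mul_bounded mb Cb0 wb mcos cos1).
- exact: (integrable_mul_bounded mb Cb0 wb msin sin1).
rewrite (@fourierE _ _ _ _ xi theta)//; last 4 first.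
- exact: (integrable_frac_laplacian_mult s_gt0 gamma_gt0 gammaE ma mcos cos1 Ca0 da).
- exact: (integrable_frac_laplacian_mult s_gt0 gamma_gt0 gammaE ma msin sin1 Ca0 da).
- exact: (integrable_frac_laplacian_mult s_gt0 gamma_gt0 gammaE mb mcos cos1 Cb0 db).
- exact: (integrable_frac_laplacian_mult s_gt0 gamma_gt0 gammaE mb msin sin1 Cb0 db).
(* Each pairing of cosine or sine with Re u or Im u acquires the same real factor, which then comes
   out of both components. *)
rewrite (Rintegral_frac_laplacian_mult s_gt0 gamma_gt0 gammaE ma mcos cos1 cosDB Ca0 wa da).
rewrite (Rintegral_frac_laplacian_mult s_gt0 gamma_gt0 gammaE ma msin sin1 sinDB Ca0 wa da).
rewrite (Rintegral_frac_laplacian_mult s_gt0 gamma_gt0 gammaE mb mcos cos1 cosDB Cb0 wb db).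
rewrite (Rintegral_frac_laplacian_mult s_gt0 gamma_gt0 gammaE mb msin sin1 sinDB Cb0 wb db).
by rewrite nxi -mulrBr -mulrDr complexZl.
Qed.
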